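(* Let $X$ be a locally finite, locally Cohen--Macaulay simplicial complex of dimension $n$. Let $h_*$ (which is concentrated in degree $n$) be its local homology sheaf and $h^*$ its local cohomology cosheaf, over $\mathbb{Z}$. Then there is a fundamental class $[X]\in H^{\mathrm{lf}}_n(X;h^* )$ in locally finite homology such that, for every $p$, the cap product induces isomorphisms $$[X]\cap-\colon H_c^p(X;h_* )\xrightarrow{\ \cong\ } H_{n-p}(X;\mathbb{Z})$$ and $$[X]\cap-\colon H_c^p(X;\mathbb{Z})\xrightarrow{\ \cong\ } H_{n-p}(X;h^* ).$$
   Context: Fix an orientation of $X$: a total order on the vertices of each simplex such that face inclusions are order preserving. $X_k$ is the set of $k$-simplices. For $\sigma\in X_k$: $\sigma_{\langle j\rangle}$ is the face omitting the $j$-th vertex, $\sigma_{\leq j}$ is the face spanned by vertices $0,\dots,j$, and $\sigma_{\geq j}$ is the face spanned by vertices $j,\dots,k$. A combinatorial sheaf $\mathcal F$ on $X$ is a covariant functor from the poset of simplices of $X$ (ordered by inclusion) to abelian groups, with maps $\mathcal F(\sigma<\tau)$; a cosheaf $\mathcal G$ is a contravariant functor, with maps $\mathcal G(\tau>\sigma)$. Sheaf cohomology with compact supports $H^*_c(X;\mathcal F)$ is the cohomology of $C_c^k(X;\mathcal F)=\bigoplus_{\sigma\in X_k}\mathcal F(\sigma)$ with $(\delta\phi)_\sigma=\sum_i(-1)^i\mathcal F(\sigma_{\langle i\rangle}<\sigma)\phi_{\sigma_{\langle i\rangle}}$. Cosheaf homology $H_*(X;\mathcal G)$ is the homology of $C_k(X;\mathcal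 G)=\bigoplus_{\sigma\in X_k}\mathcal G(\sigma)$ with differential sending $a\in\mathcal G(\sigma)$ to $\sum_i(-1)^i\mathcal G(\sigma>\sigma_{\langle i\rangle})a$; locally finite homology $H^{\mathrm{lf}}_*(X;\mathcal G)$ is obtained by replacing $\bigoplus$ by $\prod$. Coefficients $\mathbb Z$ denote the constant (co)sheaf. Let $X-\mathring{\mathrm{st}}(\sigma)$ be the subcomplex of all simplices that do not have $\sigma$ as a face. The local homology sheaf is $h_k(\sigma)=H_k(X,X-\mathring{\mathrm{st}}(\sigma);\mathbb Z)$ and the local cohomology cosheaf is $h^k(\sigma)=H^k(X,X-\mathring{\mathrm{st}}(\sigma);\mathbb Z)$, with maps for $\sigma<\tau$ induced by the inclusion of pairs $(X,X-\mathring{\mathrm{st}}(\sigma))\to(X,X-\mathring{\mathrm{st}}(\tau))$. $X$ is locally Cohen--Macaulay of dimension $n$ if $h_k(\sigma)=0$ for all (nonempty) simplices $\sigma$ and all $k\neq n$. Cap products: for $\eta\in C^{\mathrm{lf}}_k(X;h^n)$, $\phi\in C^l_c(X;h_n)$, $\psi\in C^l_c(X;\mathbb Z)$ with $l\le k$, $$\eta\cap\phi=\sum_{\sigma\in X_k}\langle h^n(\sigma>\sigma_{\geq k-l})\eta_\sigma,\phi_{\sigma_{\geq k-l}}\rangle\,\sigma_{\leq k-l}\in C_{k-l}(X;\mathbb Z),$$ $$\eta\cap\psi=\sum_{\sigma\in X_k}\psi(\sigma_{\geq k-l})\,h^n(\sigma>\sigma_{\leq k-l})\eta_\sigma\in C_{k-l}(X;h^n),$$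 where $\langle\cdot,\cdot\rangle$ is the evaluation pairing $h^n(\sigma)\otimes h_n(\sigma)\to\mathbb Z$, and $h^n(\sigma>\sigma)$, $h_n(\sigma<\sigma)$ mean identities. These descend to (co)homology. The fundamental class is the class of the locally finite cycle whose value at each $n$-simplex $\alpha$ is the generator of $h^n(\alpha)\cong\mathbb Z$ given by the cochain $\alpha^*$ dual to $\alpha$. *)

(* Defs.v *)
From HB Require Import structures.
From mathcomp Require Import all_boot all_order all_algebra.
From mathcomp Require Import finmap.
From mathcomp Require Import generic_quotient ring_quotient.
From mathcomp Require Import all_classical.

Set Implicit Arguments.
Unset Strict Implicit.
Unset Printing Implicit Defensive.

Import GRing.Theory.

Local Open Scope ring_scope.
Local Open Scope classical_set_scope.
Local Open Scope quotient_scope.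

Section Subquotient.
(** [B] need not be contained in [Z]: the quotient below is [Z / (Z :&: B)]. *)
Variables (M : zmodType) (Z B : zmodClosed M).

Record cycle := Cycle { cycle_val :> M; cycleP : cycle_val \in Z }.
HB.instance Definition _ := [isSub for cycle_val].
HB.instance Definition _ := [Choice of cycle by <:].
HB.instance Definition _ := [SubChoice_isSubZmodule of cycle by <:].

Definition null_cycle : {pred cycle} := fun z => val z \in B.

Lemma null_cycleE z : (z \in null_cycle) = (val z \in B).
Proof. by []. Qed.

Lemma null_cycle_zmod : zmod_closed null_cycle.
Proof.
split=> [|x y]; rewrite !null_cycleE; first by rewrite raddf0 rpred0.
by move=> Bx By; rewrite raddfB rpredB.
Qed.
HB.instance Definition _ :=
  GRing.isZmodClosed.Build cycle null_cycle null_cycle_zmod.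

Definition subquot : zmodType := Quotient.quot null_cycle.

Definition hclass (z : cycle) : subquot := \pi_(Quotient.quot null_cycle) z.

Definition repr_of (x : subquot) : cycle :=
  repr (x : Quotient.quot null_cycle).

Definition represents (c : M) (x : subquot) : Prop :=
  exists z : cycle, val z = c /\ x = hclass z.

Lemma represents_repr (x : subquot) : represents (val (repr_of x)) x.
Proof. by exists (repr_of x); rewrite /hclass reprK. Qed.

Lemma represents_cycle c x : represents c x -> c \in Z.
Proof. by case=> z [<- _]; exact: valP. Qed.

Lemma represents_eq c d x y : represents c x -> represents d y ->
  (x = y) <-> (c - d \in B).
Proof.
move=> [z [<- ->]] [w [<- ->]].
have -> : val z - val w = val (z - w) by rewrite raddfB.
rewrite -null_cycleE (Quotient.idealrBE null_cycle).
by split=> [zw|/eqP//]; apply/eqP.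
Qed.

Lemma represents_ex c : c \in Z -> exists x, represents c x.
Proof. by move=> cZ; exists (hclass (Cycle cZ)); exists (Cycle cZ). Qed.

Lemma representsB c d x y :
  represents c x -> represents d y -> represents (c - d) (x - y).
Proof.
move=> [z [<- ->]] [w [<- ->]]; exists (z - w).
by rewrite raddfB /hclass raddfB.
Qed.

End Subquotient.

Section SubquotientMap.
Variables (M : zmodType) (Z1 B1 Z2 B2 : zmodClosed M).
Hypothesis sZ : {subset Z1 <= Z2}.

(** The unused inclusion [sB] makes this well defined and additive. *)
Definition subquot_map (sB : {subset B1 <= B2}) (x : subquot Z1 B1) : subquot Z2 B2 :=
  hclass B2 (Cycle (sZ (valP (repr_of x)))).

Lemma subquot_mapE sB c x : represents c x -> represents c (subquot_map sB x).
Proof.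
move=> cx; have [y cy] := represents_ex B2 (sZ (represents_cycle cx)).
suff -> : subquot_map sB x = y by [].
have mx : represents (val (repr_of x)) (subquot_map sB x)
  by exists (Cycle (sZ (valP (repr_of x)))).
apply/(represents_eq mx cy); apply: (sB _ _).
exact/(represents_eq (represents_repr x) cx).
Qed.

Lemma subquot_map_is_zmod sB : zmod_morphism (subquot_map sB).
Proof.
move=> x y; have rx := represents_repr x; have ry := represents_repr y.
apply/(represents_eq (subquot_mapE sB (representsB rx ry))
         (representsB (subquot_mapE sB rx) (subquot_mapE sB ry))).
by rewrite subrr rpred0.
Qed.
HB.instance Definition _ sB :=
  GRing.isZmodMorphism.Build (subquot Z1 B1) (subquot Z2 B2)
    (subquot_map sB) (subquot_map_is_zmod sB).

End SubquotientMap.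

Arguments subquot_map {M Z1 B1 Z2 B2} sZ sB x.
Arguments subquot_mapE {M Z1 B1 Z2 B2} sZ sB [c x].

Lemma represents_fun (M : zmodType) (Z B : zmodClosed M) c (x y : subquot Z B) :
  represents c x -> represents c y -> x = y.
Proof. by move=> cx cy; apply/(represents_eq cx cy); rewrite subrr rpred0. Qed.

Section CyclesBoundaries.
Variables (M : zmodType) (d : {additive M -> M}).

Definition ker_on (C : zmodClosed M) : {pred M} :=
  fun x => (x \in C) && (d x == 0).

Definition im_on (D : zmodClosed M) : {pred M} :=
  fun x => `[< exists2 y, y \in D & x = d y >].

(** The preimages in [C] of the cycles and boundaries of the quotient of the
    complex [C] by a subcomplex [A]; in [rel_im_on], [A] is in the degree of the
    boundaries, in [rel_ker_on] it is one degree below [C]. *)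
Definition rel_ker_on (C A : zmodClosed M) : {pred M} :=
  fun x => (x \in C) && (d x \in A).

Definition rel_im_on (D A : zmodClosed M) : {pred M} :=
  fun x => `[< exists y a, [/\ y \in D, a \in A & x = d y + a] >].

Lemma ker_onE (C : zmodClosed M) x : (x \in ker_on C) = (x \in C) && (d x == 0).
Proof. by []. Qed.

Lemma im_onP (D : zmodClosed M) x : reflect (exists2 y, y \in D & x = d y) (x \in im_on D).
Proof. exact: asboolP. Qed.

Lemma rel_ker_onE (C A : zmodClosed M) x : (x \in rel_ker_on C A) = (x \in C) && (d x \in A).
Proof. by []. Qed.

Lemma rel_im_onP (D A : zmodClosed M) x :
  reflect (exists y a, [/\ y \in D, a \in A & x = d y + a]) (x \in rel_im_on D A).
Proof. exact: asboolP. Qed.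

Lemma ker_on_zmod (C : zmodClosed M) : zmod_closed (ker_on C).
Proof.
split=> [|x y]; rewrite !ker_onE; first by rewrite rpred0 raddf0 eqxx.
by move=> /andP[xC /eqP dx] /andP[yC /eqP dy]; rewrite rpredB//= raddfB dx dy subrr.
Qed.

Lemma im_on_zmod (D : zmodClosed M) : zmod_closed (im_on D).
Proof.
split=> [|x y]; first by apply/im_onP; exists 0; rewrite ?rpred0 ?raddf0.
move=> /im_onP[u uD ->] /im_onP[v vD ->]; apply/im_onP.
by exists (u - v); rewrite ?rpredB ?raddfB.
Qed.

Lemma rel_ker_on_zmod (C A : zmodClosed M) : zmod_closed (rel_ker_on C A).
Proof.
split=> [|x y]; rewrite !rel_ker_onE; first by rewrite raddf0 !rpred0.
by move=> /andP[xC dx] /andP[yC dy]; rewrite raddfB !rpredB.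
Qed.

Lemma rel_im_on_zmod (D A : zmodClosed M) : zmod_closed (rel_im_on D A).
Proof.
split=> [|x y].
  by apply/rel_im_onP; exists 0, 0; rewrite !rpred0 raddf0 addr0.
move=> /rel_im_onP[u [a [uD aA ->]]] /rel_im_onP[v [b [vD bA ->]]].
apply/rel_im_onP; exists (u - v), (a - b).
by rewrite !rpredB// raddfB opprD addrACA.
Qed.

HB.instance Definition _ C :=
  GRing.isZmodClosed.Build M (ker_on C) (ker_on_zmod C).
HB.instance Definition _ D :=
  GRing.isZmodClosed.Build M (im_on D) (im_on_zmod D).
HB.instance Definition _ C A :=
  GRing.isZmodClosed.Build M (rel_ker_on C A) (rel_ker_on_zmod C A).
HB.instance Definition _ D A :=
  GRing.isZmodClosed.Build M (rel_im_on D A) (rel_im_on_zmod D A).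

End CyclesBoundaries.

Record lf_complex (V : choiceType) := LfComplex {
  simplices : set {fset V};
  simplices_neq0 : forall s, simplices s -> s != fset0%fset;
  simplices_sub : forall s t,
    simplices t -> (s `<=` t)%fset -> s != fset0%fset -> simplices s;
  simplices_lf : forall v, finite_set [set s | simplices s /\ v \in s]
}.

Section Simplices.
Variables (V : choiceType) (X : lf_complex V).

Definition simplex := set_type (simplices X).
HB.instance Definition _ := SubChoice.on simplex.

Implicit Types rho sigma tau : simplex.

Definition dim sigma : nat := #|` val sigma|.-1.

Definition is_face sigma tau : bool := (val sigma `<=` val tau)%fset.

Lemma is_face_refl sigma : is_face sigma sigma.
Proof. exact: fsubset_refl. Qed.

Lemma is_face_trans sigma rho tau :
  is_face rho sigma -> is_face sigma tau -> is_face rho tau.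
Proof. exact: fsubset_trans. Qed.

Lemma finite_star sigma : finite_set [set tau | is_face sigma tau].
Proof.
have [v vs] : exists v, v \in val sigma.
  by apply/fset0Pn; apply: simplices_neq0; exact: (set_mem (valP sigma)).
apply: (@sub_finite_set _ _ (val @^-1` [set s | simplices X s /\ v \in s])).
  move=> tau st; split; first exact: (set_mem (valP tau)).
  exact: (fsubsetP st).
by apply: finite_preimage (simplices_lf X v) => x y _ _; exact: val_inj.
Qed.

Record orientation := Orientation {
  vle : simplex -> rel V;
  vle_anti : forall sigma, {in val sigma &, antisymmetric (vle sigma)};
  vle_trans : forall sigma, {in val sigma & &, transitive (vle sigma)};
  vle_total : forall sigma, {in val sigma &, total (vle sigma)};
  vle_face : forall sigma tau, is_face sigma tau ->
    {in val sigma &, vle sigma =2 vle tau}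
}.

Variable o : orientation.

Definition vertices sigma : seq V := sort (vle o sigma) (val sigma).

(** The face of [sigma] spanned by [s]; the junk value [sigma] is only returned
    when [s] does not span a simplex, that is when [s] is empty. *)
Definition span_face sigma (s : seq V) : simplex :=
  insubd sigma [fset v in s]%fset.

(** For [dim sigma = 0], [drop_face sigma 0] is junk. *)
Definition drop_face sigma (j : nat) : simplex :=
  span_face sigma (take j (vertices sigma) ++ drop j.+1 (vertices sigma)).

Definition front_face sigma (j : nat) : simplex :=
  span_face sigma (take j.+1 (vertices sigma)).

(** Junk for [dim sigma < j]. *)
Definition back_face sigma (j : nat) : simplex :=
  span_face sigma (drop j (vertices sigma)).

Lemma span_face_sub sigma s :
  {subset s <= vertices sigma} -> is_face (span_face sigma s) sigma.
Proof.
move=> ss; rewrite /span_face /insubd /is_face.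
case: insubP => [u _ ->|_]; last exact: fsubset_refl.
by apply/fsubsetP => v; rewrite inE/= => /ss; rewrite mem_sort.
Qed.

Lemma val_span_face sigma s : s != [::] -> {subset s <= vertices sigma} ->
  val (span_face sigma s) = [fset v in s]%fset.
Proof.
move=> s0 ss; rewrite /span_face insubdK// inE.
apply: (simplices_sub (set_mem (valP sigma))).
  by apply/fsubsetP => v; rewrite inE/= => /ss; rewrite mem_sort.
by case: s s0 ss => // v s _ _; apply/fset0Pn; exists v; rewrite !inE eqxx.
Qed.

Lemma drop_faceP sigma j : is_face (drop_face sigma j) sigma.
Proof.
by apply: span_face_sub => v; rewrite mem_cat => /orP[/mem_take|/mem_drop].
Qed.

Lemma front_faceP sigma j : is_face (front_face sigma j) sigma.
Proof. by apply: span_face_sub => v /mem_take. Qed.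

Lemma back_faceP sigma j : is_face (back_face sigma j) sigma.
Proof. by apply: span_face_sub => v /mem_drop. Qed.

End Simplices.

Section Sections.
Variables (I : Type) (S : I -> zmodType).

Definition sections : Type := forall i, S i.

Implicit Types f g h : sections.

Lemma sections_addA :
  associative (fun f g => (fun i => f i + g i) : sections).
Proof. by move=> f g h; apply: functional_extensionality_dep => i; rewrite addrA. Qed.
Lemma sections_addC :
  commutative (fun f g => (fun i => f i + g i) : sections).
Proof. by move=> f g; apply: functional_extensionality_dep => i; rewrite addrC. Qed.
Lemma sections_add0 : left_id ((fun i => 0) : sections)
  (fun f g => (fun i => f i + g i) : sections).
Proof. by move=> f; apply: functional_extensionality_dep => i; rewrite add0r. Qed.
Lemma sections_addN : left_inverse ((fun i => 0) : sections)
  (fun f => (fun i => - f i) : sections)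
  (fun f g => (fun i => f i + g i) : sections).
Proof. by move=> f; apply: functional_extensionality_dep => i; rewrite addNr. Qed.

HB.instance Definition _ := gen_eqMixin sections.
HB.instance Definition _ := gen_choiceMixin sections.
HB.instance Definition _ := GRing.isZmodule.Build sections
  sections_addA sections_addC sections_add0 sections_addN.

Lemma sectionsB f g i : (f - g) i = f i - g i.
Proof. by []. Qed.

Lemma sections0 i : (0 : sections) i = 0.
Proof. by []. Qed.

End Sections.

Section Single.
Variables (I : eqType) (S : I -> zmodType).

(** The element [a] of the summand [S i]. *)
Definition single (i : I) (a : S i) : sections S := eqtype.dfwith (0 : sections S) a.

Lemma singleB i (a b : S i) : single (a - b : S i) = single a - single b.
Proof.
apply: functional_extensionality_dep => j; rewrite sectionsB /single /eqtype.dfwith.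
by case: eqP => [e|_]; [case: _ / e | rewrite subrr].
Qed.

Lemma single_out i (a : S i) j : i != j -> single a j = 0.
Proof. exact: eqtype.dfwith_out. Qed.

End Single.

Section SheavesDef.
Variables (V : choiceType) (X : lf_complex V).

Record sheaf := Sheaf {
  stalk :> simplex X -> zmodType;
  sheaf_map : forall sigma tau : simplex X,
    is_face sigma tau -> {additive stalk sigma -> stalk tau};
  sheaf_id : forall sigma (h : is_face sigma sigma) x, sheaf_map h x = x;
  sheaf_comp : forall rho sigma tau (h1 : is_face rho sigma)
    (h2 : is_face sigma tau) (h3 : is_face rho tau) x,
    sheaf_map h3 x = sheaf_map h2 (sheaf_map h1 x)
}.

Record cosheaf := Cosheaf {
  costalk :> simplex X -> zmodType;
  cosheaf_map : forall sigma tau : simplex X,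
    is_face sigma tau -> {additive costalk tau -> costalk sigma};
  cosheaf_id : forall sigma (h : is_face sigma sigma) x, cosheaf_map h x = x;
  cosheaf_comp : forall rho sigma tau (h1 : is_face rho sigma)
    (h2 : is_face sigma tau) (h3 : is_face rho tau) x,
    cosheaf_map h3 x = cosheaf_map h1 (cosheaf_map h2 x)
}.

Definition const_sheaf : sheaf :=
  @Sheaf (fun=> int) (fun _ _ _ => idfun) (fun _ _ _ => erefl)
    (fun _ _ _ _ _ _ _ => erefl).

Definition const_cosheaf : cosheaf :=
  @Cosheaf (fun=> int) (fun _ _ _ => idfun) (fun _ _ _ => erefl)
    (fun _ _ _ _ _ _ _ => erefl).

(** Chains and cochains of degree [k] are families indexed by all simplices
    that vanish outside the [k]-simplices. The degree is an integer, so that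
    everything is [0] in negative degrees. *)
Section Degree.
Variable (S : simplex X -> zmodType).

Definition homogeneous (k : int) (f : sections S) : Prop :=
  forall sigma, (dim sigma)%:Z <> k -> f sigma = 0.

Definition dprod (k : int) : {pred sections S} :=
  fun f => `[< homogeneous k f >].

Definition dsum (k : int) : {pred sections S} :=
  fun f => `[< homogeneous k f /\ finite_set [set sigma | f sigma <> 0] >].

Lemma dprodP k f : reflect (homogeneous k f) (f \in dprod k).
Proof. exact: asboolP. Qed.

Lemma dsumP k f :
  reflect (homogeneous k f /\ finite_set [set sigma | f sigma <> 0])
    (f \in dsum k).
Proof. exact: asboolP. Qed.

Lemma dprod_zmod k : zmod_closed (dprod k).
Proof.
split=> [|f g]; first exact/dprodP.
move=> /dprodP fk /dprodP gk; apply/dprodP => sigma sk.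
by rewrite sectionsB fk// gk// subrr.
Qed.

Lemma dsum_zmod k : zmod_closed (dsum k).
Proof.
split=> [|f g].
  by apply/dsumP; split=> //; apply: (@sub_finite_set _ _ set0).
move=> /dsumP[fk ff] /dsumP[gk gf]; apply/dsumP; split.
  by move=> sigma sk; rewrite sectionsB fk// gk// subrr.
apply: (@sub_finite_set _ _ ([set sigma | f sigma <> 0] `|`
                            [set sigma | g sigma <> 0])); last first.
  by rewrite finite_setU.
move=> sigma /= fg; apply: contrapT => /not_orP[/contrapT f0 /contrapT g0].
by apply: fg; rewrite sectionsB f0 g0 subrr.
Qed.

HB.instance Definition _ k :=
  GRing.isZmodClosed.Build (sections S) (dprod k) (dprod_zmod k).
HB.instance Definition _ k :=
  GRing.isZmodClosed.Build (sections S) (dsum k) (dsum_zmod k).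

End Degree.

Arguments dprod : clear implicits.
Arguments dsum : clear implicits.

Variable o : orientation X.

(** A vertex has no faces, whence the condition [0 < dim sigma]. *)
Definition cobound (F : sheaf) (f : sections F) : sections F :=
  fun sigma => \sum_(i < (dim sigma).+1 | (0 < dim sigma)%N)
    sheaf_map F (drop_faceP o sigma i) (f (drop_face o sigma i))
      *~ ((-1) ^+ i).

Lemma cobound_is_zmod F : zmod_morphism (@cobound F).
Proof.
move=> f g; apply: functional_extensionality_dep => sigma.
rewrite sectionsB /cobound -sumrB; apply: eq_bigr => i _.
by rewrite sectionsB raddfB mulrzBl.
Qed.
HB.instance Definition _ (F : sheaf) := GRing.isZmodMorphism.Build
  (sections F) (sections F) (@cobound F) (@cobound_is_zmod F).

(** The sum over all [sigma] of the chains
    [\sum_i (-1) ^ i G(sigma > drop_face sigma i) (c sigma)]. Only finitely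
    many [sigma] contribute to the value at [tau], by local finiteness. *)
Definition bound (G : cosheaf) (c : sections G) : sections G :=
  fun tau => \sum_(sigma \in [set: simplex X])
    \sum_(i < (dim sigma).+1 | (0 < dim sigma)%N)
      single (cosheaf_map G (drop_faceP o sigma i) (c sigma)
        *~ ((-1) ^+ i)) tau.

Lemma boundE (G : cosheaf) (c : sections G) tau :
  bound c tau = \sum_(sigma \in [set sigma | is_face tau sigma])
    \sum_(i < (dim sigma).+1 | (0 < dim sigma)%N)
      single (cosheaf_map G (drop_faceP o sigma i) (c sigma)
        *~ ((-1) ^+ i)) tau.
Proof.
apply/esym/fsbig_widen => //= sigma [_ /= ns]; apply: big1 => i _.
apply: single_out; apply: contra_notN ns => /eqP <-; exact: drop_faceP.
Qed.

Lemma bound_is_zmod G : zmod_morphism (@bound G).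
Proof.
move=> f g; apply: functional_extensionality_dep => tau.
rewrite sectionsB !boundE !fsbig_finite; try exact: finite_star.
rewrite -sumrB; apply: eq_bigr => sigma _; rewrite -sumrB.
apply: eq_bigr => i _.
by rewrite sectionsB raddfB mulrzBl singleB sectionsB.
Qed.
HB.instance Definition _ (G : cosheaf) := GRing.isZmodMorphism.Build
  (sections G) (sections G) (@bound G) (@bound_is_zmod G).

Definition cohomology_c (p : int) (F : sheaf) : zmodType :=
  subquot (ker_on (@cobound F) (dsum F p)) (im_on (@cobound F) (dsum F (p - 1))).

Definition homology (k : int) (G : cosheaf) : zmodType :=
  subquot (ker_on (@bound G) (dsum G k)) (im_on (@bound G) (dsum G (k + 1))).

Definition homology_lf (k : int) (G : cosheaf) : zmodType :=
  subquot (ker_on (@bound G) (dprod G k)) (im_on (@bound G) (dprod G (k + 1))).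

End SheavesDef.

Arguments dprod {V X} S k.
Arguments dsum {V X} S k.

Section LocalHomology.
Variables (V : choiceType) (X : lf_complex V) (o : orientation X).

Implicit Types (sigma tau rho : simplex X) (k l : int).

Let ZS := const_sheaf X.
Let ZC := const_cosheaf X.

(** [C_k(A)] for [A] the subcomplex of the simplices that do not have [sigma]
    as a face. *)
Definition off_star sigma k : {pred sections ZC} := fun c =>
  (c \in dsum ZC k) && `[< forall rho, is_face sigma rho -> c rho = 0 >].

(** [C^k(X, A)] is the group of the cochains that vanish on [A]. *)
Definition rel_cochain sigma k : {pred sections ZS} := fun f =>
  (f \in dprod ZS k) && `[< forall rho, ~~ is_face sigma rho -> f rho = 0 >].

Lemma off_starP sigma k c :
  reflect (c \in dsum ZC k /\ forall rho, is_face sigma rho -> c rho = 0)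
    (c \in off_star sigma k).
Proof.
by apply: (iffP andP) => -[cS c0]; split=> //; apply/asboolP.
Qed.

Lemma rel_cochainP sigma k f :
  reflect (f \in dprod ZS k /\ forall rho, ~~ is_face sigma rho -> f rho = 0)
    (f \in rel_cochain sigma k).
Proof.
by apply: (iffP andP) => -[cS c0]; split=> //; apply/asboolP.
Qed.

Lemma off_star_zmod sigma k : zmod_closed (off_star sigma k).
Proof.
split=> [|f g]; first by apply/off_starP; rewrite rpred0.
move=> /off_starP[fk f0] /off_starP[gk g0]; apply/off_starP.
by rewrite rpredB//; split=> // rho sr; rewrite sectionsB f0// g0// subrr.
Qed.

Lemma rel_cochain_zmod sigma k : zmod_closed (rel_cochain sigma k).
Proof.
split=> [|f g]; first by apply/rel_cochainP; rewrite rpred0.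
move=> /rel_cochainP[fk f0] /rel_cochainP[gk g0]; apply/rel_cochainP.
by rewrite rpredB//; split=> // rho sr; rewrite sectionsB f0// g0// subrr.
Qed.

HB.instance Definition _ sigma k := GRing.isZmodClosed.Build (sections ZC)
  (off_star sigma k) (off_star_zmod sigma k).
HB.instance Definition _ sigma k := GRing.isZmodClosed.Build (sections ZS)
  (rel_cochain sigma k) (rel_cochain_zmod sigma k).

Let d := @bound V X o ZC.
Let delta := @cobound V X o ZS.

(** The homology of [C(X) / C(A)], as
    [{c \in C_k(X) | d c \in C_(k-1)(A)} / (d C_(k+1)(X) + C_k(A))]. *)
Definition loc_hom k sigma : zmodType :=
  subquot (rel_ker_on d (dsum ZC k) (off_star sigma (k - 1)))
    (rel_im_on d (dsum ZC (k + 1)) (off_star sigma k)).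

Definition loc_cohom k sigma : zmodType :=
  subquot (ker_on delta (rel_cochain sigma k))
    (im_on delta (rel_cochain sigma (k - 1))).

Lemma off_star_sub k sigma tau : is_face sigma tau ->
  {subset off_star sigma k <= off_star tau k}.
Proof.
move=> st c /off_starP[ck c0]; apply/off_starP; split=> // rho tr.
exact/c0/(is_face_trans st).
Qed.

Lemma rel_cochain_sub k sigma tau : is_face sigma tau ->
  {subset rel_cochain tau k <= rel_cochain sigma k}.
Proof.
move=> st f /rel_cochainP[fk f0]; apply/rel_cochainP; split=> // rho sr.
by apply/f0; apply: contra sr; exact: is_face_trans.
Qed.

Section LocalMaps.
Variables (k : int) (sigma tau : simplex X) (st : is_face sigma tau).

Lemma loc_hom_cycle :
  {subset rel_ker_on d (dsum ZC k) (off_star sigma (k - 1))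
       <= rel_ker_on d (dsum ZC k) (off_star tau (k - 1))}.
Proof.
by move=> c; rewrite !rel_ker_onE => /andP[-> /=]; exact: off_star_sub.
Qed.

Lemma loc_hom_boundary :
  {subset rel_im_on d (dsum ZC (k + 1)) (off_star sigma k)
       <= rel_im_on d (dsum ZC (k + 1)) (off_star tau k)}.
Proof.
move=> c /rel_im_onP[b [a [bk ak ->]]]; apply/rel_im_onP; exists b, a.
by split=> //; exact: off_star_sub ak.
Qed.

Lemma loc_cohom_cycle :
  {subset ker_on delta (rel_cochain tau k)
       <= ker_on delta (rel_cochain sigma k)}.
Proof.
by move=> f; rewrite !ker_onE => /andP[fk ->]; rewrite (rel_cochain_sub st).
Qed.

Lemma loc_cohom_boundary :
  {subset im_on delta (rel_cochain tau (k - 1))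
       <= im_on delta (rel_cochain sigma (k - 1))}.
Proof.
move=> f /im_onP[g gk ->]; apply/im_onP; exists g => //.
exact: rel_cochain_sub gk.
Qed.

Definition loc_hom_map : {additive loc_hom k sigma -> loc_hom k tau} :=
  subquot_map loc_hom_cycle loc_hom_boundary.

Definition loc_cohom_map : {additive loc_cohom k tau -> loc_cohom k sigma} :=
  subquot_map loc_cohom_cycle loc_cohom_boundary.

End LocalMaps.

Lemma loc_hom_id k sigma (h : is_face sigma sigma) x : loc_hom_map k h x = x.
Proof.
have rx := represents_repr x.
exact: (represents_fun (subquot_mapE _ _ rx) rx).
Qed.

Lemma loc_hom_comp k rho sigma tau (h1 : is_face rho sigma)
    (h2 : is_face sigma tau) (h3 : is_face rho tau) x :
  loc_hom_map k h3 x = loc_hom_map k h2 (loc_hom_map k h1 x).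
Proof.
have rx := represents_repr x.
apply: (represents_fun (subquot_mapE _ _ rx)).
exact: (subquot_mapE _ _ (subquot_mapE _ _ rx)).
Qed.

Lemma loc_cohom_id k sigma (h : is_face sigma sigma) x :
  loc_cohom_map k h x = x.
Proof.
have rx := represents_repr x.
exact: (represents_fun (subquot_mapE _ _ rx) rx).
Qed.

Lemma loc_cohom_comp k rho sigma tau (h1 : is_face rho sigma)
    (h2 : is_face sigma tau) (h3 : is_face rho tau) x :
  loc_cohom_map k h3 x = loc_cohom_map k h1 (loc_cohom_map k h2 x).
Proof.
have rx := represents_repr x.
apply: (represents_fun (subquot_mapE _ _ rx)).
exact: (subquot_mapE _ _ (subquot_mapE _ _ rx)).
Qed.

Definition loc_hom_sheaf k : sheaf X :=
  Sheaf (@loc_hom_id k) (@loc_hom_comp k).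

Definition loc_cohom_cosheaf k : cosheaf X :=
  Cosheaf (@loc_cohom_id k) (@loc_cohom_comp k).

Definition locally_CM (n : nat) : Prop :=
  forall (k : int) sigma, k <> n%:Z -> forall x : loc_hom k sigma, x = 0.

Definition evaluate (f : sections ZS) (c : sections ZC) : int :=
  \sum_(rho \in [set: simplex X]) (f rho : int) * (c rho : int).

(** The evaluation pairing; by [pairingE] below it does not depend on the
    choice of representatives. *)
Definition pairing k sigma (a : loc_cohom k sigma) (b : loc_hom k sigma) : int :=
  evaluate (val (repr_of a)) (val (repr_of b)).

Lemma evaluate_supp f c (D : set (simplex X)) :
    (forall rho, ~ D rho -> (f rho : int) * (c rho : int) = 0) ->
  evaluate f c = \sum_(rho \in D) (f rho : int) * (c rho : int).
Proof.
by move=> D0; apply/esym/fsbig_widen => // rho [_ /= nD]; exact: D0.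
Qed.

Let finsupp (c : sections ZC) := finite_set [set rho | c rho <> 0].

Lemma evaluate0 f c :
  (forall rho, (f rho : int) * (c rho : int) = 0) -> evaluate f c = 0.
Proof. by move=> fc0; apply: fsbig1 => rho _. Qed.

Lemma evaluateBl f g c : finsupp c ->
  evaluate (f - g) c = evaluate f c - evaluate g c.
Proof.
move=> cf; have out h rho : ~ [set rho | c rho <> 0] rho ->
    (h rho : int) * (c rho : int) = 0.
  by move=> /contrapT ->; rewrite mulr0.
rewrite !(evaluate_supp (@out _)) !fsbig_finite// -sumrB.
by apply: eq_bigr => rho _; rewrite sectionsB mulrBl.
Qed.

Lemma evaluateBr f b c : finsupp b -> finsupp c ->
  evaluate f (b - c) = evaluate f b - evaluate f c.
Proof.
move=> bf cf.
pose D := [set rho | b rho <> 0] `|` [set rho | c rho <> 0].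
have Df : finite_set D by rewrite finite_setU.
rewrite !(@evaluate_supp _ _ D) ?fsbig_finite// -?sumrB.
- by apply: eq_bigr => rho _; rewrite sectionsB mulrBr.
- by move=> rho /not_orP[_ /contrapT ->]; rewrite mulr0.
- by move=> rho /not_orP[/contrapT -> _]; rewrite mulr0.
- move=> rho /not_orP[/contrapT b0 /contrapT c0].
  by rewrite sectionsB b0 c0 subrr mulr0.
Qed.

Lemma evaluate_cobound f c : finsupp c ->
  evaluate (delta f) c = evaluate f (d c).
Proof.
move=> cf; pose S := [set sigma | c sigma <> 0].
pose T := \bigcup_(sigma in S)
  ((fun i => drop_face o sigma i) @` `I_(dim sigma).+1).
have Tf : finite_set T.
  by apply: bigcup_finite => // sigma _; apply/finite_image/finite_II.
have dcE tau : d c tau = \sum_(sigma \in S)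
    \sum_(i < (dim sigma).+1 | (0 < dim sigma)%N)
      single (c sigma *~ ((-1) ^+ i) : ZC (drop_face o sigma i)) tau.
  apply/esym/fsbig_widen => // sigma [_ /contrapT c0] /=.
  by apply: big1 => i _; rewrite c0 mul0rz /single /eqtype.dfwith; case: eqP => // e; case: _ / e.
rewrite (@evaluate_supp _ _ S); last by move=> rho /contrapT ->; rewrite mulr0.
rewrite (@evaluate_supp _ _ T); last first.
  move=> tau nT; rewrite dcE fsbig1 ?mulr0// => sigma Ss.
  apply: big1 => i _; apply: single_out; apply: contra_notN nT => /eqP <-.
  by exists sigma => //; exists (val i) => //=.
rewrite !fsbig_finite//.
transitivity (\sum_(tau <- fset_set T) \sum_(sigma <- fset_set S)
    \sum_(i < (dim sigma).+1 | (0 < dim sigma)%N)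
      (f tau : int) * (single (c sigma *~ ((-1) ^+ i) : ZC (drop_face o sigma i)) tau : int)).
  rewrite exchange_big/=; apply: eq_big_seq => sigma sS.
  rewrite exchange_big/= mulr_suml; apply: eq_bigr => i _.
  rewrite (bigD1_seq (drop_face o sigma i))/= ?fset_uniq//; last first.
    rewrite in_fset_set// inE; exists sigma; last by exists (val i) => //=.
    by move: sS; rewrite in_fset_set// inE.
  rewrite big1 ?addr0; last by move=> tau; rewrite eq_sym => nt; rewrite single_out ?mulr0.
  by rewrite /single eqtype.dfwith_in mulrzAl mulrzAr.
apply: eq_bigr => tau _; rewrite dcE fsbig_finite// mulr_sumr.
by apply: eq_bigr => sigma _; rewrite mulr_sumr.
Qed.

Lemma pairingE k sigma (a : loc_cohom k sigma) (b : loc_hom k sigma) f c :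
  represents f a -> represents c b -> pairing a b = evaluate f c.
Proof.
move=> fa cb; rewrite /pairing.
have ra := represents_repr a; have rb := represents_repr b.
set f' := val (repr_of a) in ra *; set c' := val (repr_of b) in rb *.
have /im_onP[g /rel_cochainP[_ g0] fg] := (represents_eq fa ra).1 erefl.
have /rel_im_onP[y [z [/dsumP[_ yf] /off_starP[/dsumP[_ zf] z0] cy]]] :=
  (represents_eq cb rb).1 erefl.
have := represents_cycle fa; rewrite ker_onE => /andP[/rel_cochainP[_ f0] /eqP df].
have := represents_cycle ra; rewrite ker_onE => /andP[/rel_cochainP[_ f'0] /eqP df'].
have := represents_cycle cb; rewrite rel_ker_onE => /andP[/dsumP[_ cf] /off_starP[_ dc]].
have := represents_cycle rb; rewrite rel_ker_onE => /andP[/dsumP[_ cf'] _].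
apply/esym/eqP; rewrite -subr_eq0.
have -> : evaluate f c - evaluate f' c' =
    (evaluate f c - evaluate f' c) + (evaluate f' c - evaluate f' c').
  by rewrite addrA subrK.
rewrite -evaluateBl// -evaluateBr// fg evaluate_cobound//.
rewrite evaluate0 ?add0r; last first.
  move=> rho; case: (boolP (is_face sigma rho)) => sr.
    by rewrite [X in _ * X](dc rho sr) mulr0.
  by rewrite g0// mul0r.
have zE : z = (c - c') - d y by rewrite cy addrC addKr.
have dyE : d y = (c - c') - z by rewrite cy addrK.
have fz : evaluate f' z = 0.
  apply: evaluate0 => rho; case: (boolP (is_face sigma rho)) => sr.
    by rewrite z0// mulr0.
  by rewrite f'0// mul0r.
have ccf : finsupp (c - c').
  apply: (@sub_finite_set _ _ ([set rho | c rho <> 0] `|`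
                               [set rho | c' rho <> 0])); last first.
    by rewrite finite_setU.
  move=> rho /= cc; apply: contrapT => /not_orP[/contrapT h /contrapT h'].
  by apply: cc; rewrite sectionsB h h' subrr.
have : evaluate (delta f') y = 0.
  apply: evaluate0 => rho.
  by rewrite [X in X * _](congr1 (fun h : sections ZS => h rho) df') mul0r.
by rewrite evaluate_cobound// dyE (evaluateBr f' ccf zf) [X in _ - X]fz subr0 => ->.
Qed.

End LocalHomology.

Section Cap.
Variables (V : choiceType) (X : lf_complex V) (o : orientation X) (n : nat).

Let hn_sheaf := loc_hom_sheaf o n%:Z.
Let hn_cosheaf := loc_cohom_cosheaf o n%:Z.

(** The cap products of [eta] of degree [k] with a cochain of degree [l].
    For [k < l] or [l < 0] the cochain vanishes at the back faces below, which
    then are not [l]-simplices, and the cap products are [0]. *)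
Definition cap_hom (k l : int) (eta : sections hn_cosheaf)
    (phi : sections hn_sheaf) : sections (const_cosheaf X) :=
  fun tau => \sum_(sigma \in [set sigma : simplex X | (dim sigma)%:Z = k])
    single (pairing
        (cosheaf_map hn_cosheaf (back_faceP o sigma (absz (k - l))) (eta sigma))
        (phi (back_face o sigma (absz (k - l))))
      : const_cosheaf X (front_face o sigma (absz (k - l)))) tau.

Definition cap_const (k l : int) (eta : sections hn_cosheaf)
    (psi : sections (const_sheaf X)) : sections hn_cosheaf :=
  fun tau => \sum_(sigma \in [set sigma : simplex X | (dim sigma)%:Z = k])
    single
      (cosheaf_map hn_cosheaf (front_faceP o sigma (absz (k - l))) (eta sigma)
        *~ (psi (back_face o sigma (absz (k - l))) : int)) tau.

(** The value at each [n]-simplex [alpha] of the cycle representing [x] is the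
    class of the cochain dual to [alpha]. *)
Definition fundamental_class (x : homology_lf o n%:Z hn_cosheaf) : Prop :=
  exists2 xi, represents xi x &
    forall alpha : simplex X, dim alpha = n ->
      represents (single (1 : const_sheaf X alpha)) (xi alpha).

End Cap.

(* Main.v *)
(** Local homology is computed by [C_q(X, X - st(sigma))], the free group on the
    [q]-simplices having [sigma] as a face, and the Cohen-Macaulay condition says
    that this complex is exact except in its top degree [n]. In the double complex
    [D_(p,q) = C_c^p(X; C_q(X, X - st))], with one basis element for each pair of
    simplices [sigma <= tau] of dimensions [p] and [q], fixing [sigma] thus gives a
    complex whose only homology is [C_c^p(X; h_n)], at [q = n], while fixing [tau]
    gives the cochain complex of the simplex [tau], whose only cohomology is the
    copy of [Z] in [p = 0] that makes up [C_q(X; Z)]. The map sending the basis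
    element [sigma <= tau] to the front face of [tau] if [sigma] is the
    complementary back face, and to [0] otherwise, commutes with the differentials
    up to sign; on [q = n] it is the cap product with the fundamental class, and on
    [p = 0] it splits the inclusion of [C_q(X; Z)]. Moving along staircases from
    [q = n] to [p = 0] and back then gives bijectivity. The second isomorphism is
    the same argument in the transposed double complex [C_p(X; C^q(X, X - st))];
    there the exactness for fixed [sigma] follows by transposing a contraction of
    [C(X, X - st(sigma))] in degrees below [n]. *)

From HB Require Import structures.
Require Import Defs.
From mathcomp Require Import all_boot all_order all_algebra.
From mathcomp Require Import finmap all_classical.
From mathcomp Require Import zify ring.

Set Implicit Arguments.
Unset Strict Implicit.
Unset Printing Implicit Defensive.

Import GRing.Theory.

Local Open Scope ring_scope.

(* The names [dim] and [repr_of] of Defs are shadowed by those of MathComp. *)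
Local Notation dim := Defs.dim.
Local Notation repr_of := Defs.repr_of.

(** The two halves are not quite symmetric. No simplex has dimension above [n], so a class in [h_n]
    has only one representing cycle on the star, and [C_c^p(X; h_n)] is the kernel of [star_bound]
    in bidegree [(p, n)]. For the same reason every [n]-cochain on a star is a cocycle, so
    [C_p(X; h^n)] is a cokernel: equations in it hold for representatives only up to a term
    [cobound_snd h], and the staircases of the second half carry such terms along. Stalks are
    subquotients indexed by simplices. To keep away from quotients and from transport along
    equalities of simplices, the arguments take place among integer functions of two simplices;
    [represents_hom] and [represents_coh] link these to sections. Supports have to stay finite
    although [X] may be infinite: a chosen preimage is taken to be 0 in every summand where the
    datum is 0, and local finiteness bounds how far an operator spreads a support. *)

Lemma alternating_square_sum0 (N : nat) (a : nat -> nat -> int) :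
    (forall i j, (j <= i)%N -> (i < N)%N -> a i.+1 j = - a j i) ->
  \sum_(i < N.+1) \sum_(j < N) a i j = 0.
Proof.
move=> aP.
(* The square is cut along the diagonal. Shifting [i] by one turns the part [j < i] into minus the
   transpose of the part [i <= j], as for two successive face maps. *)
have -> : \sum_(i < N.+1) \sum_(j < N) a i j =
    \sum_(j < N) \sum_(i < N.+1 | (j < i)%N) a i j +
    \sum_(j < N) \sum_(i < N.+1 | (i <= j)%N) a i j.
  rewrite exchange_big/= -big_split/=; apply: eq_bigr => j _.
  rewrite (bigID (fun i : 'I_N.+1 => (j < i)%N))/=; congr (_ + _).
  by apply: eq_bigl => i; rewrite -leqNgt.
have -> : \sum_(j < N) \sum_(i < N.+1 | (j < i)%N) a i j =
    \sum_(j < N) \sum_(i < N | (j <= i)%N) - a j i.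
  apply: eq_bigr => j _; rewrite big_mkcond big_ord_recl/= add0r [RHS]big_mkcond/=.
  by apply: eq_bigr => i _; rewrite /bump/= add1n ltnS; case: ifP => // ji; rewrite aP.
apply/eqP; rewrite addr_eq0 -sumrN; apply/eqP.
rewrite (exchange_big_dep predT)//=; apply: eq_bigr => j _.
rewrite sumrN; congr (- _).
rewrite [RHS]big_mkcond big_ord_recr/= leqNgt ltn_ord/= addr0 [LHS]big_mkcond/=.
by [].
Qed.

Lemma big_seq_widen (I : eqType) (M : nmodType) (s t : seq I) (F : I -> M) :
    uniq s -> uniq t -> (forall x, F x != 0 -> (x \in s) = (x \in t)) ->
  \sum_(x <- s) F x = \sum_(x <- t) F x.
Proof.
move=> us ut st.
rewrite (bigID (fun x => F x != 0)) [RHS](bigID (fun x => F x != 0)) /=.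
rewrite [X in _ + X]big1 => [|x /negPn/eqP//].
rewrite [X in _ = _ + X]big1 => [|x /negPn/eqP//].
rewrite !addr0 -big_filter -[RHS]big_filter; apply/perm_big/uniq_perm; rewrite ?filter_uniq//.
by move=> x; rewrite !mem_filter; case: eqP => //= /eqP/st.
Qed.

Lemma big_seq_delta (I : eqType) (s : seq I) (F : I -> int) x :
  uniq s -> x \in s -> \sum_(y <- s) (x == y)%:R * F y = F x.
Proof.
move=> us xs; rewrite (bigD1_seq x)//= eqxx mul1r big1 ?addr0// => y.
by rewrite eq_sym => /negPf ->; rewrite mul0r.
Qed.

(** * Lists with one entry cut out, the vertex lists of codimension-one faces *)

Lemma take_cutout (T : Type) (s : seq T) i m : (m < i <= size s)%N ->
  take m.+1 (take i s ++ drop i.+1 s) = take m.+1 s.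
Proof. by move=> /andP[mi is_]; rewrite takel_cat ?size_takel// take_takel. Qed.

Lemma drop_cutout_le (T : Type) (s : seq T) i m : (i <= m)%N -> (i <= size s)%N ->
  drop m (take i s ++ drop i.+1 s) = drop m.+1 s.
Proof.
move=> im is_; rewrite drop_cat size_takel// ltnNge im/= drop_drop.
by congr drop; lia.
Qed.

Lemma take_cutout_le (T : Type) (s : seq T) i m : (i <= m)%N -> (i <= size s)%N ->
  take m (take i s ++ drop i.+1 s) = take i s ++ drop i.+1 (take m.+1 s).
Proof.
move=> im is_; rewrite take_cat size_takel// ltnNge im/= take_drop.
by congr (_ ++ drop _ (take _ _)); lia.
Qed.

Lemma drop_cutout (T : Type) (s : seq T) i m : (m <= i <= size s)%N ->
  drop m (take i s ++ drop i.+1 s) = take (i - m) (drop m s) ++ drop i.+1 s.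
Proof.
move=> /andP[mi is_]; rewrite drop_cat size_takel// take_drop subnK//.
case: ltnP => // im; have -> : m = i by lia.
by rewrite subnn drop0 (@drop_oversize _ _ (take i s)) ?size_takel.
Qed.

Lemma subr_neq0_or (x y : int) : x - y != 0 -> x != 0 \/ y != 0.
Proof. by case: (eqVneq x 0) => [->|]; [rewrite sub0r oppr_eq0; right | left]. Qed.

Lemma fun_mulz (T : Type) (M : zmodType) (f : T -> M) (k : int) x :
  (f *~ k) x = f x *~ k.
Proof.
have mulnE n : (f *+ n) x = f x *+ n.
  by elim: n => // n IH; rewrite !mulrS -IH.
by case: k => n; rewrite /intmul/= -mulnE.
Qed.

Lemma sections_sumE (I : Type) (S : I -> zmodType) J (r : seq J) (P : pred J)
    (F : J -> sections S) i :
  (\sum_(j <- r | P j) F j) i = \sum_(j <- r | P j) F j i.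
Proof. by elim/big_rec2: _ => // j x y _ <-. Qed.

Lemma sections_mulnE (I : Type) (S : I -> zmodType) (F : sections S) (l : nat) i :
  (F *+ l) i = F i *+ l.
Proof. by elim: l => // l IH; rewrite !mulrS -IH. Qed.

Lemma sections_mulzE (I : Type) (S : I -> zmodType) (F : sections S) (k : int) i :
  (F *~ k) i = F i *~ k.
Proof.
by case: k => l; rewrite /intmul/= -sections_mulnE.
Qed.

(** * Representatives of classes in subquotients *)

Section Represents.
Variables (M : zmodType) (Z B : zmodClosed M).
Implicit Types (c d : M) (x y : subquot Z B).

Lemma represents0 : represents 0 (0 : subquot Z B).
Proof.
have r0 := represents_repr (0 : subquot Z B).
by have := representsB r0 r0; rewrite !subrr.
Qed.

Lemma representsN c x : represents c x -> represents (- c) (- x).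
Proof. by move=> /(representsB represents0); rewrite !sub0r. Qed.

Lemma representsD c d x y : represents c x -> represents d y -> represents (c + d) (x + y).
Proof. by move=> cx /representsN dy; have := representsB cx dy; rewrite !opprK. Qed.

Lemma representsMz c x (k : int) : represents c x -> represents (c *~ k) (x *~ k).
Proof.
move=> cx; have MnP n : represents (c *+ n) (x *+ n).
  by elim: n => [|n IH]; [exact: represents0 | rewrite !mulrS; exact: representsD].
by case: k => n; rewrite -?pmulrn// !NegzE !mulrNz; exact/representsN/MnP.
Qed.

Lemma represents_sum I (r : seq I) (P : pred I) (c : I -> M) (x : I -> subquot Z B) :
    (forall i, P i -> represents (c i) (x i)) ->
  represents (\sum_(i <- r | P i) c i) (\sum_(i <- r | P i) x i).
Proof.
move=> cx; elim/big_ind2: _ => //; first exact: represents0.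
by move=> ? ? ? ?; exact: representsD.
Qed.

Lemma represents_eq0 c x : represents c x -> (x = 0) <-> (c \in B).
Proof. by move=> cx; rewrite (represents_eq cx represents0) subr0. Qed.

Lemma represents_congr c d x : represents c x -> c - d \in B -> d \in Z -> represents d x.
Proof.
move=> cx cd /(represents_ex B)[y dy]; suff -> : x = y by [].
exact/(represents_eq cx dy).
Qed.

End Represents.

(** [single] transports along [i = j], but all representatives lie in one group [M], where the
    transport becomes a factor 0 or 1. *)
Lemma represents_single (I : eqType) (M : zmodType) (Z B : I -> zmodClosed M)
    (i j : I) (c : M) (x : subquot (Z i) (B i)) : represents c x ->
  represents (c *+ (i == j))
    (single (S := fun i => subquot (Z i) (B i)) x j).
Proof.
move=> cx; rewrite /single /eqtype.dfwith; case: eqP => [e|_]; last exact: represents0.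
by case: _ / e.
Qed.

Lemma single_const (I : eqType) (M : zmodType) (i j : I) (a : M) :
  single (S := fun=> M) (i := i) a j = a *+ (i == j).
Proof.
by rewrite /single /eqtype.dfwith; case: eqP => // e; case: _ / e.
Qed.

Section InducedIso.
Variables (M1 M2 : zmodType) (Z1 B1 : zmodClosed M1) (Z2 B2 : zmodClosed M2).
Variable F : M1 -> M2.
Hypothesis FB : forall x y, x \in Z1 -> y \in Z1 -> F (x - y) = F x - F y.
Hypothesis FZ : {subset Z1 <= [preim F of Z2]}.
Hypothesis F_boundary : forall x, x \in Z1 -> (F x \in B2) = (x \in B1).
Hypothesis F_surj : forall z, z \in Z2 -> exists2 x, x \in Z1 & z - F x \in B2.

Definition induced_map (x : subquot Z1 B1) : subquot Z2 B2 :=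
  hclass B2 (Cycle (FZ (valP (repr_of x)))).

Lemma induced_mapE c x : represents c x -> represents (F c) (induced_map x).
Proof.
move=> cx; have rx := represents_repr x.
have cZ := represents_cycle cx; have rZ := represents_cycle rx.
have mx : represents (F (val (repr_of x))) (induced_map x).
  by exists (Cycle (FZ (valP (repr_of x)))).
apply: (represents_congr mx); last exact: FZ.
by rewrite -FB// F_boundary; [exact: (represents_eq rx cx).1 erefl | exact: rpredB].
Qed.

Lemma induced_map_is_zmod : zmod_morphism induced_map.
Proof.
move=> x y; have rx := represents_repr x; have ry := represents_repr y.
apply: (represents_fun (induced_mapE (representsB rx ry))).
rewrite FB ?(represents_cycle rx) ?(represents_cycle ry)//.
by apply: representsB; exact: induced_mapE.
Qed.
HB.instance Definition _ := GRing.isZmodMorphism.Build _ _ induced_map induced_map_is_zmod.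

(** The equivalence [F_boundary] gives both well-definedness and injectivity. [F] is a plain
    function, additive on cycles, because a cap product is computed here through representatives of
    cocycles. *)
Lemma induced_iso : exists2 Phi : {additive subquot Z1 B1 -> subquot Z2 B2},
  bijective Phi & forall c x, represents c x -> represents (F c) (Phi x).
Proof.
exists induced_map; last exact: induced_mapE.
have inj : injective induced_map.
  move=> x y xy; have rx := represents_repr x; have ry := represents_repr y.
  apply/(represents_eq rx ry).
  have := induced_mapE (representsB rx ry); rewrite raddfB/= xy subrr.
  move=> /represents_eq0-/iffLR/(_ erefl).
  by rewrite F_boundary//; exact: represents_cycle (representsB rx ry).
have surj y : exists x, induced_map x = y.
  have ry := represents_repr y; have [c cZ yc] := F_surj (represents_cycle ry).
  have [x cx] := represents_ex B1 cZ; exists x.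
  by apply/esym/(represents_eq ry (induced_mapE cx)).
have [g gK] := choice surj.
by exists g => // x; apply: inj; rewrite gK.
Qed.

End InducedIso.

(** Serves the degrees [p < 0] and [p > n], where both groups vanish. *)
Lemma trivial_iso (M1 M2 : zmodType) (Z1 B1 : zmodClosed M1) (Z2 B2 : zmodClosed M2)
    (F : M1 -> M2) : F 0 = 0 -> (forall x, x \in Z1 -> x = 0) ->
    (forall x, x \in Z2 -> x = 0) ->
  exists2 Phi : {additive subquot Z1 B1 -> subquot Z2 B2},
    bijective Phi & forall y x, represents y x -> represents (F y) (Phi x).
Proof.
move=> F0 Z10 Z20; apply: induced_iso.
- by move=> x y /Z10 -> /Z10 ->; rewrite subrr F0 subrr.
- by move=> x /Z10 ->; rewrite inE F0 rpred0.
- by move=> x /Z10 ->; rewrite F0 !rpred0.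
- by move=> z /Z20 ->; exists 0; rewrite ?rpred0// F0 subrr rpred0.
Qed.

(** * Faces of oriented simplices *)

Section LocalDuality.
Variables (V : choiceType) (X : lf_complex V) (o : orientation X).
Implicit Types (sigma tau rho kappa : simplex X).

Definition faces sigma : seq (simplex X) :=
  fset_set [set tau | is_face tau sigma]%classic.

Definition star sigma : seq (simplex X) :=
  fset_set [set tau | is_face sigma tau]%classic.

Lemma mem_faces sigma tau : (tau \in faces sigma) = is_face tau sigma.
Proof.
rewrite in_fset_set; first by apply/idP/idP; rewrite inE.
apply: (@sub_finite_set _ _ (val @^-1` [set` fpowerset (val sigma)])%classic).
  by move=> x /= xs; rewrite fpowersetE.
by apply: finite_preimage; [move=> x y _ _; exact: val_inj | exact: finite_fset].
Qed.

Lemma mem_star sigma tau : (tau \in star sigma) = is_face sigma tau.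
Proof.
by rewrite in_fset_set; [apply/idP/idP; rewrite inE | exact: finite_star].
Qed.

Lemma faces_uniq sigma : uniq (faces sigma). Proof. exact: fset_uniq. Qed.
Lemma star_uniq sigma : uniq (star sigma). Proof. exact: fset_uniq. Qed.

Lemma mem_vertices sigma : vertices o sigma =i val sigma.
Proof. by move=> x; rewrite mem_sort. Qed.

Lemma vertices_uniq sigma : uniq (vertices o sigma).
Proof. by rewrite sort_uniq fset_uniq. Qed.

Lemma size_vertices sigma : size (vertices o sigma) = (dim sigma).+1.
Proof.
rewrite size_sort /dim prednK// cardfs_gt0; apply: simplices_neq0.
exact: (set_mem (valP sigma)).
Qed.

Lemma vertices_neq0 sigma : vertices o sigma != [::].
Proof. by rewrite -size_eq0 size_vertices. Qed.

(** Reduces every identity between iterated faces to vertex lists, where faces are made of [take]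
    and [drop]. *)
Lemma vertices_inj : injective (vertices o).
Proof.
move=> s t st; apply/val_inj/eqP/fset_eqP => x.
by rewrite -!mem_vertices st.
Qed.

Lemma vertices_sorted sigma : sorted (vle o sigma) (vertices o sigma).
Proof. by apply: (sort_sorted_in (@vle_total _ _ o sigma)); apply/allP. Qed.

Lemma sorted_vertices sigma s : {subset s <= val sigma} -> uniq s ->
  sorted (vle o sigma) s -> s =i val sigma -> vertices o sigma = s.
Proof.
move=> ss us sos smem; apply: (@sorted_eq_in _ (vle o sigma)) => //.
- by move=> x y z; rewrite !mem_vertices; exact: vle_trans.
- by move=> x y; rewrite !mem_vertices; exact: vle_anti.
- exact: vertices_sorted.
- by apply: uniq_perm => //; [exact: vertices_uniq | move=> x; rewrite mem_vertices smem].
Qed.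

Lemma vertices_face sigma tau : is_face sigma tau ->
  vertices o sigma = [seq x <- vertices o tau | x \in val sigma].
Proof.
move=> st; apply: sorted_vertices.
- by move=> x; rewrite mem_filter => /andP[].
- by rewrite filter_uniq// vertices_uniq.
- rewrite (@eq_in_sorted _ (mem (val sigma)) _ (vle o tau)); last first.
  + by apply/allP => x; rewrite mem_filter => /andP[].
  + by move=> x y xs ys; exact: vle_face st x y xs ys.
  apply: (sorted_filter_in (P := mem (val tau))); last exact: vertices_sorted.
    exact: vle_trans.
  by apply/allP => x; rewrite mem_vertices.
- by move=> x; rewrite mem_filter mem_vertices andb_idr//; exact: (fsubsetP st).
Qed.

Lemma is_faceE sigma tau :
  is_face sigma tau = subseq (vertices o sigma) (vertices o tau).
Proof.
apply/idP/idP => [/vertices_face ->|/mem_subseq st]; first exact: filter_subseq.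
by apply/fsubsetP => x; rewrite -!mem_vertices => /st.
Qed.

Lemma vertices_span sigma s : s != [::] -> subseq s (vertices o sigma) ->
  vertices o (span_face sigma s) = s.
Proof.
move=> s0 ss; have ss' := mem_subseq ss.
have vE := val_span_face s0 ss'.
have st : is_face (span_face sigma s) sigma by exact: span_face_sub ss'.
rewrite (vertices_face st) vE; have /esym := subseq_uniqP (vertices_uniq sigma) ss.
by apply: etrans; apply: eq_filter => x; rewrite !inE.
Qed.

Lemma dim_size sigma : dim sigma = (size (vertices o sigma)).-1.
Proof. by rewrite size_vertices. Qed.

Lemma vertices_drop sigma i : (0 < dim sigma)%N -> (i <= dim sigma)%N ->
  vertices o (drop_face o sigma i) =
  take i (vertices o sigma) ++ drop i.+1 (vertices o sigma).
Proof.
move=> d0 id; apply: vertices_span.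
  by rewrite -size_eq0 size_cat size_takel ?size_drop size_vertices; lia.
set s := vertices o sigma; rewrite -{3}(cat_take_drop i s).
apply: cat_subseq => //; rewrite -[i.+1]add1n -drop_drop; exact: drop_subseq.
Qed.

Lemma vertices_front sigma j :
  vertices o (front_face o sigma j) = take j.+1 (vertices o sigma).
Proof.
apply: vertices_span; last exact: take_subseq.
by rewrite -size_eq0 size_take size_vertices; case: ifP.
Qed.

Lemma vertices_back sigma j : (j <= dim sigma)%N ->
  vertices o (back_face o sigma j) = drop j (vertices o sigma).
Proof.
move=> jd; apply: vertices_span; last exact: drop_subseq.
by rewrite -size_eq0 size_drop size_vertices; lia.
Qed.

Lemma dim_front sigma j : (j <= dim sigma)%N -> dim (front_face o sigma j) = j.
Proof. by move=> jd; rewrite dim_size vertices_front size_takel// size_vertices. Qed.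

Lemma dim_back sigma j : (j <= dim sigma)%N -> dim (back_face o sigma j) = (dim sigma - j)%N.
Proof. by move=> jd; rewrite dim_size vertices_back// size_drop size_vertices; lia. Qed.

Lemma dim_drop sigma i : (0 < dim sigma)%N -> (i <= dim sigma)%N ->
  dim (drop_face o sigma i) = (dim sigma).-1.
Proof.
move=> d0 id; rewrite dim_size vertices_drop// size_cat size_takel ?size_drop size_vertices; lia.
Qed.

Lemma is_face_dim sigma tau : is_face sigma tau -> (dim sigma <= dim tau)%N.
Proof.
by move=> st; rewrite /Defs.dim -!subn1 leq_sub2r// fsubset_leq_card.
Qed.

Lemma is_face_eq sigma tau : is_face sigma tau -> dim sigma = dim tau -> sigma = tau.
Proof.
move=> st; rewrite !dim_size !size_vertices/= => dst.
apply/val_inj/eqP; rewrite eqEfcard; apply/andP; split=> //.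
have := size_vertices sigma; have := size_vertices tau.
by rewrite !size_sort dst => <- ->.
Qed.

Implicit Types (g c psi : simplex X -> int).

(** The simplicial identity; [1 < dim sigma] keeps both double faces nonempty. *)
Lemma drop_dropC sigma i j : (1 < dim sigma)%N -> (j <= i < dim sigma)%N ->
  drop_face o (drop_face o sigma i.+1) j = drop_face o (drop_face o sigma j) i.
Proof.
move=> d1 /andP[ji id]; apply: vertices_inj.
have sz := size_vertices sigma.
do 4![rewrite vertices_drop ?dim_drop//; try lia].
set s := vertices o sigma in sz *.
rewrite (@drop_cutout _ s i.+1 j.+1) ?sz//; last lia.
rewrite takel_cat ?size_takel ?sz ?take_takel//; try lia.
rewrite take_cutout_le ?sz//; last lia.
rewrite (@drop_cutout_le _ s j i.+1) ?sz//; try lia.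
by rewrite -catA subSS take_drop; congr (_ ++ (drop _ (take _ _) ++ _)); lia.
Qed.

(** * Front and back faces of codimension-one faces *)

Section CapFaces.
Variables (tau : simplex X) (m : nat).
Hypothesis mt : (m < dim tau)%N.

Lemma back_drop_le i : (i <= m)%N ->
  back_face o (drop_face o tau i) m = back_face o tau m.+1.
Proof.
move=> im; apply: vertices_inj.
rewrite !vertices_back ?dim_drop ?vertices_drop//; try lia.
by rewrite drop_cutout_le// size_vertices; lia.
Qed.

Lemma front_drop_le i : (i <= m)%N ->
  front_face o (drop_face o tau i) m = drop_face o (front_face o tau m.+1) i.
Proof.
move=> im; apply: vertices_inj.
rewrite vertices_front !vertices_drop ?dim_front ?vertices_front//; try lia.
rewrite take_cutout_le ?size_vertices//; try lia.
by rewrite take_takel//; lia.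
Qed.

Lemma back_drop_gt i : (m < i <= dim tau)%N ->
  back_face o (drop_face o tau i) m = drop_face o (back_face o tau m) (i - m).
Proof.
move=> /andP[im id]; apply: vertices_inj.
rewrite vertices_back ?dim_drop// ?vertices_drop ?dim_back ?vertices_back//; try lia.
rewrite drop_cutout ?size_vertices; last lia.
by rewrite drop_drop; congr (_ ++ drop _ _); lia.
Qed.

Lemma front_drop_gt i : (m < i <= dim tau)%N ->
  front_face o (drop_face o tau i) m = front_face o tau m.
Proof.
move=> /andP[im id]; apply: vertices_inj.
rewrite !vertices_front vertices_drop//; last lia.
by rewrite take_cutout// size_vertices; lia.
Qed.

(** Together with [drop_front_last] this shows that the last face of one front face and the first
    face of one back face form the same pair; the two terms cancel in [zcobound_cap]. *)
Lemma drop0_back : drop_face o (back_face o tau m) 0 = back_face o tau m.+1.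
Proof.
apply: vertices_inj.
rewrite vertices_drop ?dim_back ?vertices_back//; try lia.
by rewrite take0 drop_drop add1n.
Qed.

Lemma drop_front_last : drop_face o (front_face o tau m.+1) m.+1 = front_face o tau m.
Proof.
apply: vertices_inj.
rewrite vertices_drop ?dim_front ?vertices_front//.
rewrite take_takel// drop_oversize ?cats0// size_takel// size_vertices; lia.
Qed.

End CapFaces.

(** * Integral chains and cochains *)

Definition zcobound g sigma : int :=
  \sum_(i < (dim sigma).+1 | (0 < dim sigma)%N) (-1) ^+ i * g (drop_face o sigma i).

(** Defined through [zcobound], so that [zbound] is its transpose by construction, with the same
    convention on vertices. *)
Definition incidence sigma rho : int := zcobound (fun x => (x == rho)%:R) sigma.

Definition zbound c rho : int := \sum_(sigma <- star rho) incidence sigma rho * c sigma.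

Lemma zcobound_is_zmod : zmod_morphism zcobound.
Proof.
move=> f g; apply/funext => s; transitivity (zcobound f s - zcobound g s) => //.
by rewrite /zcobound -sumrB; apply: eq_bigr => i _; rewrite -mulrBr.
Qed.
HB.instance Definition _ := GRing.isZmodMorphism.Build
  (simplex X -> int) (simplex X -> int) zcobound zcobound_is_zmod.

Lemma zbound_is_zmod : zmod_morphism zbound.
Proof.
move=> f g; apply/funext => s; transitivity (zbound f s - zbound g s) => //.
by rewrite /zbound -sumrB; apply: eq_bigr => i _; rewrite -mulrBr.
Qed.
HB.instance Definition _ := GRing.isZmodMorphism.Build
  (simplex X -> int) (simplex X -> int) zbound zbound_is_zmod.

Lemma zcobound_dim0 g sigma : dim sigma = 0%N -> zcobound g sigma = 0.
Proof. by move=> d0; rewrite /zcobound d0 big_pred0. Qed.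

Lemma zcoboundE g sigma d : dim sigma = d.+1 ->
  zcobound g sigma = \sum_(0 <= i < d.+2) (-1) ^+ i * g (drop_face o sigma i).
Proof. by move=> de; rewrite /zcobound de/= big_mkord. Qed.

Lemma eq_zcobound f g sigma :
    (forall rho, is_face rho sigma -> dim sigma = (dim rho).+1 -> f rho = g rho) ->
  zcobound f sigma = zcobound g sigma.
Proof.
move=> fg; apply: eq_bigr => i d0; rewrite fg//; first exact: drop_faceP.
by rewrite dim_drop// ?prednK// -ltnS.
Qed.

Lemma zcobound_neq0 g sigma : zcobound g sigma != 0 ->
  exists rho, [/\ is_face rho sigma, dim sigma = (dim rho).+1 & g rho != 0].
Proof.
move=> cg; case: (posnP (dim sigma)) => d0; first by rewrite zcobound_dim0 ?eqxx in cg.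
apply: contrapT => nex; case/eqP: cg; apply: big1 => i _.
apply/eqP; rewrite mulf_eq0; apply/orP; right; apply/negPn/negP => gi.
apply: nex; exists (drop_face o sigma i); split=> //; first exact: drop_faceP.
by rewrite dim_drop// ?prednK// -ltnS.
Qed.

Lemma incidence_neq0 sigma rho : incidence sigma rho != 0 ->
  is_face rho sigma /\ dim sigma = (dim rho).+1.
Proof.
move=> /zcobound_neq0[r [rs ds]]; by case: (eqVneq r rho) => [<-//|_]; rewrite eqxx.
Qed.

Lemma zcobound_faces g sigma : zcobound g sigma = \sum_(rho <- faces sigma) incidence sigma rho * g rho.
Proof.
under eq_bigr do rewrite mulr_suml.
rewrite exchange_big/=; apply: eq_bigr => i _.
under eq_bigr do rewrite -mulrA.
rewrite -mulr_sumr big_seq_delta ?faces_uniq// mem_faces; exact: drop_faceP.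
Qed.

Lemma zcobound_seq g sigma (s : seq (simplex X)) : uniq s ->
    (forall rho, incidence sigma rho != 0 -> g rho != 0 -> rho \in s) ->
  zcobound g sigma = \sum_(rho <- s) incidence sigma rho * g rho.
Proof.
move=> us hs; rewrite zcobound_faces; apply: big_seq_widen => //; first exact: faces_uniq.
move=> rho; rewrite mulf_eq0 negb_or => /andP[i0 g0].
by rewrite hs// mem_faces; case: (incidence_neq0 i0).
Qed.

Lemma zbound_seq c rho (s : seq (simplex X)) : uniq s ->
    (forall sigma, incidence sigma rho != 0 -> c sigma != 0 -> sigma \in s) ->
  zbound c rho = \sum_(sigma <- s) incidence sigma rho * c sigma.
Proof.
move=> us hs; apply: big_seq_widen => //; first exact: star_uniq.
move=> sigma; rewrite mulf_eq0 negb_or => /andP[i0 g0].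
by rewrite hs// mem_star; case: (incidence_neq0 i0).
Qed.

Lemma zbound_neq0 c rho : zbound c rho != 0 ->
  exists sigma, [/\ is_face rho sigma, dim sigma = (dim rho).+1 & c sigma != 0].
Proof.
move=> dc; apply: contrapT => nex; case/eqP: dc; apply: big1 => s _.
apply/eqP; rewrite mulf_eq0; apply/negPn/negP; rewrite negb_or => /andP[i0 c0].
by apply: nex; exists s; case: (incidence_neq0 i0).
Qed.

Lemma eq_zbound f g rho : (forall sigma, is_face rho sigma -> f sigma = g sigma) ->
  zbound f rho = zbound g rho.
Proof.
by move=> fg; apply: eq_big_seq => s; rewrite mem_star => /fg ->.
Qed.

Lemma zcoboundK g : zcobound (zcobound g) = 0.
Proof.
apply/funext => sigma; change (zcobound (zcobound g) sigma = 0).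
case d0 : (dim sigma) => [|[|d]]; first exact: zcobound_dim0.
  rewrite /zcobound; apply: big1 => i _; rewrite [X in _ * X]big_pred0 ?mulr0// => j.
  have id : (i <= dim sigma)%N by rewrite -ltnS.
  by rewrite dim_drop ?d0.
pose a i j : int := (-1) ^+ (i + j) * g (drop_face o (drop_face o sigma i) j).
rewrite -(@alternating_square_sum0 d.+2 a); last first.
  move=> i j ji id; rewrite /a drop_dropC ?d0//; last by rewrite ji.
  by rewrite addSn exprS mulN1r mulNr addnC.
rewrite (@zcoboundE _ _ d.+1)// big_mkord; apply: eq_bigr => i _.
rewrite (@zcoboundE _ _ d) ?big_mkord; last by rewrite dim_drop d0//= -ltnS.
by rewrite mulr_sumr; apply: eq_bigr => j _; rewrite mulrA -exprD.
Qed.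

Lemma zcoboundMr g (a : int) sigma : zcobound (fun x => g x * a) sigma = zcobound g sigma * a.
Proof. by rewrite /zcobound mulr_suml; apply: eq_bigr => i _; rewrite mulrA. Qed.

(** The two ends of an edge cancel: the 0-cochain with constant value 1 is a cocycle. *)
Lemma zcobound_vertices sigma : zcobound (fun x => (dim x == 0%N)%:R) sigma = 0.
Proof.
case ds : (dim sigma) => [|[|d]]; first by rewrite zcobound_dim0.
  by rewrite (zcoboundE _ ds) !big_nat_recr//= big_geq// !dim_drop ?ds.
rewrite (zcoboundE _ ds) big_nat big1// => i /andP[_ id].
by rewrite dim_drop ?ds// mulr0.
Qed.

Lemma zcobound_incidence tau kappa : zcobound (incidence^~ kappa) tau = 0.
Proof. exact: (congr1 (fun f => f tau) (zcoboundK (fun x => (x == kappa)%:R))). Qed.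

(** Transposed from [zcoboundK]: the coefficient of each [c tau] is a double coboundary of an
    indicator function. *)
Lemma zboundK c : zbound (zbound c) = 0.
Proof.
apply/funext => kappa; change (zbound (zbound c) kappa = 0).
transitivity (\sum_(tau <- star kappa) c tau *
    \sum_(rho <- star kappa) incidence tau rho * incidence rho kappa); last first.
  apply: big1 => tau _; rewrite -zcobound_seq ?zcobound_incidence ?mulr0 ?star_uniq//.
  by move=> rho _ /incidence_neq0[]; rewrite mem_star.
rewrite /zbound; under [RHS]eq_bigr do rewrite mulr_sumr.
rewrite [RHS]exchange_big/=; apply: eq_big_seq => rho; rewrite mem_star => kr.
rewrite -[X in _ * X]/(zbound c rho) (@zbound_seq _ _ (star kappa)) ?star_uniq//.
  by rewrite mulr_sumr; apply: eq_bigr => tau _; ring.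
by move=> sigma /incidence_neq0[rs _] _; rewrite mem_star; exact: is_face_trans rs.
Qed.

(** [s] has to be closed only where [g] or [c] is nonzero, which admits both the faces and the star
    of a fixed simplex. *)
Lemma zcobound_adj g c (s : seq (simplex X)) : uniq s ->
    (forall sigma rho, sigma \in s -> incidence sigma rho != 0 -> g rho != 0 -> rho \in s) ->
    (forall sigma rho, rho \in s -> incidence sigma rho != 0 -> c sigma != 0 -> sigma \in s) ->
  \sum_(sigma <- s) zcobound g sigma * c sigma = \sum_(rho <- s) g rho * zbound c rho.
Proof.
move=> us hg hc.
transitivity (\sum_(sigma <- s) \sum_(rho <- s) incidence sigma rho * g rho * c sigma).
  apply: eq_big_seq => sigma ss; rewrite (zcobound_seq us) ?mulr_suml// => rho.
  exact: hg.
rewrite exchange_big/=; apply: eq_big_seq => rho rs; rewrite (zbound_seq us).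
  by rewrite mulr_sumr; apply: eq_bigr => sigma _; ring.
by move=> sigma; exact: hc.
Qed.

(** Both Leibniz rules come from this identity. A face of [tau] omitting a vertex up to [m] changes
    the front part, any other one the back part. The right side has two extra terms, the last face
    of the front and face 0 of the back; they have the same value and opposite signs. *)
Lemma zcobound_cap (F : simplex X -> simplex X -> int) tau m : (m < dim tau)%N ->
  zcobound (fun rho => F (back_face o rho m) (front_face o rho m)) tau =
  zcobound (F (back_face o tau m.+1)) (front_face o tau m.+1) +
  (-1) ^+ m * zcobound (F^~ (front_face o tau m)) (back_face o tau m).
Proof.
move=> mt; case de : (dim tau) => [|d]; first by rewrite de in mt.
rewrite (zcoboundE _ de) (@zcoboundE _ _ m) ?dim_front//.
rewrite (@zcoboundE _ (back_face o tau m) (d - m)) ?dim_back ?de//; try lia.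
rewrite (big_cat_nat (n := m.+1))//=; last by lia.
rewrite [X in _ = X + _]big_nat_recr//= [X in _ + _ * X]big_nat_recl//=.
rewrite drop_front_last// drop0_back// exprS.
rewrite (@eq_big_nat _ _ _ 0 m.+1 _ (fun i => (-1) ^+ i *
  F (back_face o tau m.+1) (drop_face o (front_face o tau m.+1) i))); last first.
  by move=> i /andP[_ im]; rewrite back_drop_le ?front_drop_le.
set A := \sum_(0 <= i < m.+1) _.
rewrite mulrDr -!addrA; congr (A + _).
rewrite mulN1r mulNr mul1r addKr.
rewrite -{1}(add0n m.+1) big_addn mulr_sumr.
have -> : (d.+2 - m.+1 = (d - m).+1)%N by lia.
apply: eq_big_nat => i /andP[_ idm].
rewrite back_drop_gt ?front_drop_gt ?de//; try lia.
have -> : (i + m.+1 - m = i.+1)%N by lia.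
by rewrite addnS -addSn exprD [X in X * _ = _]mulrC -mulrA.
Qed.

(** * The two double complexes *)

Implicit Types (f h : simplex X -> simplex X -> int) (k p q : int) (m : nat).

Local Open Scope classical_set_scope.

(** Also used for compactly supported cochains, which are the same integer functions. *)
Definition chains k : {pred simplex X -> int} := fun c =>
  `[< (forall sigma, c sigma != 0 -> (dim sigma)%:Z = k) /\
      finite_set [set sigma | c sigma != 0] >].

(** The common underlying group, in bidegree [(p, q)], of two double complexes:
    [C_c^p(X; C_q(X, X - st))], with the differentials [star_cobound] and
    [star_bound], and [C_p(X; C^q(X, X - st))], with the differentials [bound_fst]
    and [cobound_snd]. The basis element at [sigma <= tau] is [tau] in the
    summand of [sigma]. *)
Definition pairs p q : {pred simplex X -> simplex X -> int} := fun f =>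
  `[< (forall sigma tau, f sigma tau != 0 ->
        [/\ is_face sigma tau, (dim sigma)%:Z = p & (dim tau)%:Z = q]) /\
      finite_set [set sigma | exists tau, f sigma tau != 0] >].

Lemma chainsP k c : reflect
  ((forall sigma, c sigma != 0 -> (dim sigma)%:Z = k) /\
    finite_set [set sigma | c sigma != 0]) (c \in chains k).
Proof. exact: asboolP. Qed.

Lemma pairsP p q f : reflect
  ((forall sigma tau, f sigma tau != 0 ->
     [/\ is_face sigma tau, (dim sigma)%:Z = p & (dim tau)%:Z = q]) /\
   finite_set [set sigma | exists tau, f sigma tau != 0]) (f \in pairs p q).
Proof. exact: asboolP. Qed.

Lemma chains_zmod k : zmod_closed (chains k).
Proof.
split=> [|f g].
  by apply/chainsP; split=> [s /eqP[]//|]; apply: (@sub_finite_set _ _ set0) => // s /= /eqP[].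
move=> /chainsP[fk ff] /chainsP[gk gf]; apply/chainsP; split.
  by move=> s /subr_neq0_or[/fk|/gk].
apply: (@sub_finite_set _ _ ([set s | f s != 0] `|` [set s | g s != 0])).
  by move=> s /= /subr_neq0_or.
by rewrite finite_setU.
Qed.
HB.instance Definition _ k :=
  GRing.isZmodClosed.Build (simplex X -> int) (chains k) (chains_zmod k).

Lemma pairs_zmod p q : zmod_closed (pairs p q).
Proof.
split=> [|f g].
  apply/pairsP; split=> [s t /eqP[]//|].
  by apply: (@sub_finite_set _ _ set0) => // s /= [t /eqP[]].
move=> /pairsP[fk ff] /pairsP[gk gf]; apply/pairsP; split.
  by move=> s t /subr_neq0_or[/fk|/gk].
apply: (@sub_finite_set _ _ ([set s | exists t, f s t != 0] `|`
                             [set s | exists t, g s t != 0])).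
  by move=> s /= [t /subr_neq0_or[?|?]]; [left|right]; exists t.
by rewrite finite_setU.
Qed.
HB.instance Definition _ p q :=
  GRing.isZmodClosed.Build (simplex X -> simplex X -> int) (pairs p q) (pairs_zmod p q).

Lemma finite_faces tau : finite_set [set sigma | is_face sigma tau].
Proof.
apply: (@sub_finite_set _ _ [set` faces tau]); last exact: finite_seq.
by move=> s /=; rewrite mem_faces.
Qed.

Lemma finite_link sigma :
  finite_set [set rho | exists2 tau, is_face sigma tau & is_face rho tau].
Proof.
apply: (@sub_finite_set _ _
  (\bigcup_(tau in [set tau | is_face sigma tau]) [set rho | is_face rho tau])).
  by move=> r [t st rt]; exists t.
by apply: bigcup_finite => [|t _]; [exact: finite_star | exact: finite_faces].
Qed.

(** Each [sigma] in the support of [h] shares a coface [rho] with one of finitely many simplices,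
    and local finiteness leaves finitely many such [sigma]. *)
Lemma pairs_spread p q p' q' f h : f \in pairs p q ->
    (forall sigma tau, h sigma tau != 0 ->
      [/\ is_face sigma tau, (dim sigma)%:Z = p' & (dim tau)%:Z = q']) ->
    (forall sigma tau, h sigma tau != 0 -> exists sigma' tau' rho,
      [/\ f sigma' tau' != 0, is_face sigma' rho & is_face sigma rho]) ->
  h \in pairs p' q'.
Proof.
move=> /pairsP[_ ff] h1 h2; apply/pairsP; split=> //.
apply: (@sub_finite_set _ _ (\bigcup_(s in [set s | exists t, f s t != 0])
   [set rho | exists2 tau, is_face s tau & is_face rho tau])).
  move=> s [t /h2[s' [t' [r [fs' s'r sr]]]]].
  by exists s'; [exists t' | exists r].
by apply: bigcup_finite => // s _; exact: finite_link.
Qed.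

Lemma pairs_to_chains p q k f c : f \in pairs p q ->
    (forall sigma, c sigma != 0 -> (dim sigma)%:Z = k) ->
    (forall sigma, c sigma != 0 -> exists sigma' tau' rho,
      [/\ f sigma' tau' != 0, is_face sigma' rho & is_face sigma rho]) ->
  c \in chains k.
Proof.
move=> /pairsP[_ ff] h1 h2; apply/chainsP; split=> //.
apply: (@sub_finite_set _ _ (\bigcup_(s in [set s | exists t, f s t != 0])
   [set rho | exists2 tau, is_face s tau & is_face rho tau])).
  move=> s /h2[s' [t' [r [fs' s'r sr]]]].
  by exists s'; [exists t' | exists r].
by apply: bigcup_finite => // s _; exact: finite_link.
Qed.

Lemma chains_to_pairs k p q c f : c \in chains k ->
    (forall sigma tau, f sigma tau != 0 ->
      [/\ is_face sigma tau, (dim sigma)%:Z = p & (dim tau)%:Z = q]) ->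
    (forall sigma tau, f sigma tau != 0 -> exists sigma' rho,
      [/\ c sigma' != 0, is_face sigma' rho & is_face sigma rho]) ->
  f \in pairs p q.
Proof.
move=> /chainsP[_ ff] h1 h2; apply/pairsP; split=> //.
apply: (@sub_finite_set _ _ (\bigcup_(s in [set s | c s != 0])
   [set rho | exists2 tau, is_face s tau & is_face rho tau])).
  move=> s [t /h2[s' [r [fs' s'r sr]]]].
  by exists s'; [done | exists r].
by apply: bigcup_finite => // s _; exact: finite_link.
Qed.

(** In [star_bound] and [star_cobound] a face of [tau] may fail to contain [sigma], and a coface of
    [sigma] may fail to lie in [tau]. The truncation discards these terms, which is the passage to
    the quotient [C(X, X - st sigma)]. *)
Definition star_bound f sigma rho : int := if is_face sigma rho then zbound (f sigma) rho else 0.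
Definition star_cobound f sigma tau : int := if is_face sigma tau then zcobound (f^~ tau) sigma else 0.
Definition cap_pairs m f rho : int :=
  \sum_(tau <- star rho) (front_face o tau m == rho)%:R * f (back_face o tau m) tau.

(** Enlarging [tau] or shrinking [sigma] preserves [sigma <= tau], so [cobound_snd] and [bound_fst]
    stay among the pairs without truncation. *)
Definition cobound_snd f sigma : simplex X -> int := zcobound (f sigma).
Definition bound_fst f kappa tau : int := zbound (f^~ tau) kappa.
Definition augmentation f tau : int := \sum_(sigma <- faces tau | dim sigma == 0%N) f sigma tau.
(** The transpose of [cap_pairs m]. *)
Definition cap_section m psi sigma tau : int :=
  if (m <= dim tau)%N then (front_face o tau m == sigma)%:R * psi (back_face o tau m)
  else 0.

Ltac pointwise := apply/funext => s; apply/funext => t.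

Lemma star_bound_is_zmod : zmod_morphism star_bound.
Proof.
move=> f g; pointwise; transitivity (star_bound f s t - star_bound g s t) => //.
rewrite /star_bound; case: ifP => _; last by rewrite subrr.
by rewrite -[f - g]/(fun x => f x - g x) raddfB.
Qed.
HB.instance Definition _ := GRing.isZmodMorphism.Build _ _ star_bound star_bound_is_zmod.

Lemma star_cobound_is_zmod : zmod_morphism star_cobound.
Proof.
move=> f g; pointwise; transitivity (star_cobound f s t - star_cobound g s t) => //.
rewrite /star_cobound; case: ifP => _; last by rewrite subrr.
by rewrite -[(f - g)^~ t]/(f^~ t - g^~ t) raddfB.
Qed.
HB.instance Definition _ := GRing.isZmodMorphism.Build _ _ star_cobound star_cobound_is_zmod.

Lemma cap_pairs_is_zmod m : zmod_morphism (cap_pairs m).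
Proof.
move=> f g; apply/funext => s; transitivity (cap_pairs m f s - cap_pairs m g s) => //.
by rewrite /cap_pairs -sumrB; apply: eq_bigr => i _; rewrite -mulrBr.
Qed.
HB.instance Definition _ m := GRing.isZmodMorphism.Build _ _ (cap_pairs m) (cap_pairs_is_zmod m).

Lemma cobound_snd_is_zmod : zmod_morphism cobound_snd.
Proof. by move=> f g; apply/funext => s; exact: (raddfB zcobound). Qed.
HB.instance Definition _ := GRing.isZmodMorphism.Build _ _ cobound_snd cobound_snd_is_zmod.

Lemma bound_fst_is_zmod : zmod_morphism bound_fst.
Proof.
move=> f g; pointwise; transitivity (bound_fst f s t - bound_fst g s t) => //.
by rewrite /bound_fst -[(f - g)^~ t]/(f^~ t - g^~ t) raddfB.
Qed.
HB.instance Definition _ := GRing.isZmodMorphism.Build _ _ bound_fst bound_fst_is_zmod.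

Lemma augmentation_is_zmod : zmod_morphism augmentation.
Proof.
by move=> f g; apply/funext => s; transitivity (augmentation f s - augmentation g s) => //; rewrite /augmentation -sumrB.
Qed.
HB.instance Definition _ := GRing.isZmodMorphism.Build _ _ augmentation augmentation_is_zmod.

Lemma cap_section_is_zmod m : zmod_morphism (cap_section m).
Proof.
move=> f g; pointwise; transitivity (cap_section m f s t - cap_section m g s t) => //.
by rewrite /cap_section; case: ifP => _; rewrite ?subrr// -mulrBr.
Qed.
HB.instance Definition _ m := GRing.isZmodMorphism.Build _ _ (cap_section m) (cap_section_is_zmod m).

Lemma star_bound_pairs p q f : f \in pairs p q -> star_bound f \in pairs p (q - 1).
Proof.
move=> fP; have /pairsP[f0 _] := fP; apply: (pairs_spread fP) => s t; rewrite /star_bound.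
  case: ifP => [st /zbound_neq0[r [tr dr /f0[sr sp rq]]]|_]; last by rewrite eqxx.
  by split=> //; lia.
case: ifP => [st /zbound_neq0[r [tr dr fsr]]|_]; last by rewrite eqxx.
by exists s, r, s; split=> //; exact: is_face_refl.
Qed.

Lemma star_cobound_pairs p q f : f \in pairs p q -> star_cobound f \in pairs (p + 1) q.
Proof.
move=> fP; have /pairsP[f0 _] := fP; apply: (pairs_spread fP) => s t; rewrite /star_cobound.
  case: ifP => [st /zcobound_neq0[r [rs dr /f0[rt rp tq]]]|_]; last by rewrite eqxx.
  by split=> //; lia.
case: ifP => [st /zcobound_neq0[r [rs dr frt]]|_]; last by rewrite eqxx.
by exists r, t, s; split=> //; exact: is_face_refl.
Qed.

Lemma cobound_snd_pairs p q f : f \in pairs p q -> cobound_snd f \in pairs p (q + 1).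
Proof.
move=> fP; have /pairsP[f0 _] := fP; apply: (pairs_spread fP) => s t.
  move=> /zcobound_neq0[r [rt dr /f0[sr sp rq]]].
  by split=> //; [exact: is_face_trans rt | lia].
move=> /zcobound_neq0[r [rs dr fsr]].
by exists s, r, s; split=> //; exact: is_face_refl.
Qed.

Lemma bound_fst_pairs p q f : f \in pairs p q -> bound_fst f \in pairs (p - 1) q.
Proof.
move=> fP; have /pairsP[f0 _] := fP; apply: (pairs_spread fP) => s t.
  move=> /zbound_neq0[r [sr dr /f0[rt rp tq]]].
  by split=> //; [exact: is_face_trans rt | lia].
move=> /zbound_neq0[r [sr dr frt]].
by exists r, t, r; split=> //; exact: is_face_refl.
Qed.

Lemma cap_pairs_chains p q m f : f \in pairs p q -> q = m%:Z + p -> 0 <= p ->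
  cap_pairs m f \in chains m%:Z.
Proof.
move=> fP qE p0; have /pairsP[f0 _] := fP.
have capP rho : cap_pairs m f rho != 0 ->
    exists2 tau, front_face o tau m = rho & f (back_face o tau m) tau != 0.
  move=> cr; apply: contrapT => nex; case/eqP: cr; apply: big1 => t _.
  case: eqP => [e|_]; last by rewrite mul0r.
  rewrite mul1r; apply/eqP/negPn/negP => ft; by apply: nex; exists t.
apply: (pairs_to_chains fP) => r /capP[t <- ft]; have [bt bp tq] := f0 _ _ ft.
  by rewrite dim_front//; lia.
by exists (back_face o t m), t, t; split=> //; exact: front_faceP.
Qed.

Lemma augmentation_chains q f : f \in pairs 0 q -> augmentation f \in chains q.
Proof.
move=> fP; have /pairsP[f0 _] := fP.
have aP tau : augmentation f tau != 0 -> exists sigma, f sigma tau != 0.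
  move=> at0; apply: contrapT => nex; case/eqP: at0; apply: big1 => s _.
  by apply/eqP/negPn/negP => fs; apply: nex; exists s.
apply: (pairs_to_chains fP) => t /aP[s fs]; have [st bp tq] := f0 _ _ fs => //.
by exists s, t, t; split=> //; exact: is_face_refl.
Qed.

Lemma cap_section_pairs k m psi : psi \in chains k -> 0 <= k -> cap_section m psi \in pairs m%:Z (m%:Z + k).
Proof.
move=> pk k0; have /chainsP[p0 _] := pk; apply: (chains_to_pairs pk) => s t; rewrite /cap_section.
  case: ifP => [mt|_]; last by rewrite eqxx.
  case: (_ =P s) => [<-|_]; last by rewrite mul0r eqxx.
  rewrite mul1r => /p0; rewrite dim_back// dim_front// => tk.
  by split=> //; [exact: front_faceP | lia].
case: ifP => [mt|_]; last by rewrite eqxx.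
case: (_ =P s) => [<-|_]; last by rewrite mul0r eqxx.
rewrite mul1r => pb; exists (back_face o t m), t; split=> //.
  exact: back_faceP.
exact: front_faceP.
Qed.

Lemma cobound_sndK f : cobound_snd (cobound_snd f) = 0.
Proof. by apply/funext => s; rewrite /cobound_snd zcoboundK. Qed.

Lemma bound_fstK f : bound_fst (bound_fst f) = 0.
Proof. by pointwise; exact: (congr1 (fun g => g s) (zboundK (f^~ t))). Qed.

(** The differentials carry no total-complex sign and therefore commute; the powers of -1 appear in
    the Leibniz rules instead. *)
Lemma cobound_snd_bound_fst f : cobound_snd (bound_fst f) = bound_fst (cobound_snd f).
Proof.
pointwise; rewrite /cobound_snd /bound_fst zcobound_faces /zbound.
under eq_bigr do rewrite mulr_sumr.
rewrite exchange_big/=; apply: eq_bigr => r _.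
by rewrite zcobound_faces mulr_sumr; apply: eq_bigr => r' _; ring.
Qed.

Lemma star_boundK f : star_bound (star_bound f) = 0.
Proof.
pointwise; rewrite {1}/star_bound; case: ifP => // st.
rewrite -[RHS](congr1 (fun g => g t) (zboundK (f s))).
by apply: eq_zbound => r tr; rewrite /star_bound (is_face_trans st).
Qed.

Lemma star_coboundK f : star_cobound (star_cobound f) = 0.
Proof.
pointwise; rewrite {1}/star_cobound; case: ifP => // st.
rewrite -[RHS](congr1 (fun g => g s) (zcoboundK (f^~ t))).
by apply: eq_zcobound => r tr _; rewrite /star_cobound (is_face_trans tr).
Qed.

Lemma star_bound_cobound f : star_bound (star_cobound f) = star_cobound (star_bound f).
Proof.
pointwise; rewrite {1}/star_bound {2}/star_cobound; case: ifP => // st.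
rewrite (@eq_zbound _ (fun tau => zcobound (f^~ tau) s)); last first.
  by move=> r tr; rewrite /star_cobound (is_face_trans st).
rewrite (@eq_zcobound _ (fun rho => zbound (f rho) t)); last first.
  by move=> r rs _; rewrite /star_bound (is_face_trans rs).
rewrite zcobound_faces /zbound; under [RHS]eq_bigr do rewrite mulr_sumr.
rewrite exchange_big/=; apply: eq_bigr => r _.
by rewrite zcobound_faces mulr_sumr; apply: eq_bigr => r' _; ring.
Qed.

(** * Exactness in the first variable *)

Definition join0 tau sigma : simplex X :=
  span_face tau (vertices o (front_face o tau 0) ++ vertices o sigma).

(** The cone from the first vertex of [tau], as a contraction of the cochain
    complex of [tau]. *)
Definition cone tau g sigma : int :=
  if is_face (front_face o tau 0) sigma then 0 else g (join0 tau sigma).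

Lemma vertices_front0 tau : exists2 x, vertices o (front_face o tau 0) = [:: x] &
  exists t, vertices o tau = x :: t.
Proof.
have := vertices_front tau 0; have := vertices_neq0 tau.
by case: (vertices o tau) => // x t _ ->; exists x; [rewrite /= take0 | exists t].
Qed.

Section Join.
Variables (tau sigma : simplex X).
Hypotheses (st : is_face sigma tau) (nv : ~~ is_face (front_face o tau 0) sigma).

Lemma vertices_join0 : vertices o (join0 tau sigma) =
  vertices o (front_face o tau 0) ++ vertices o sigma.
Proof.
have [x vx [t vt]] := vertices_front0 tau.
apply: vertices_span; first by rewrite vx.
move: st nv; rewrite !is_faceE vx vt/= sub1seq eqxx.
case: (vertices o sigma) => [|y u]/=; first by rewrite sub0seq.
case: eqP => [->|//].
by rewrite mem_head.
Qed.

Lemma join0_face : is_face (join0 tau sigma) tau.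
Proof.
apply: (@span_face_sub _ _ o) => x; rewrite mem_cat !mem_vertices => /orP[|].
  exact: (fsubsetP (front_faceP o tau 0)).
exact: (fsubsetP st).
Qed.

Lemma dim_join0 : dim (join0 tau sigma) = (dim sigma).+1.
Proof.
have [x vx _] := vertices_front0 tau.
by rewrite dim_size vertices_join0 vx/= size_vertices.
Qed.

Lemma drop_join0 : drop_face o (join0 tau sigma) 0 = sigma.
Proof.
have [x vx _] := vertices_front0 tau.
apply: vertices_inj; rewrite vertices_drop ?dim_join0// vertices_join0 vx.
by rewrite take0/= drop0.
Qed.

Lemma drop_join0S i : (0 < dim sigma)%N -> (i <= dim sigma)%N ->
  drop_face o (join0 tau sigma) i.+1 = join0 tau (drop_face o sigma i).
Proof.
move=> d0 id; have [x vx _] := vertices_front0 tau.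
apply: vertices_inj; rewrite vertices_drop ?dim_join0// vertices_join0 vx.
rewrite /join0 vx vertices_span//= vertices_drop//.
have <- : vertices o (drop_face o (join0 tau sigma) i.+1) =
    x :: take i (vertices o sigma) ++ drop i.+1 (vertices o sigma).
  by rewrite vertices_drop ?dim_join0// vertices_join0 vx.
rewrite -is_faceE; apply: is_face_trans (join0_face); exact: drop_faceP.
Qed.

Lemma drop_join01 : dim sigma = 0%N ->
  drop_face o (join0 tau sigma) 1 = front_face o tau 0.
Proof.
move=> d0; have [x vx _] := vertices_front0 tau.
apply: vertices_inj; rewrite vertices_drop ?dim_join0// vertices_join0 vx/=.
by rewrite take0 drop_oversize// size_vertices d0.
Qed.

End Join.

Section Contains.
Variables (tau sigma : simplex X).
Hypotheses (st : is_face sigma tau) (fs : is_face (front_face o tau 0) sigma).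

Lemma vertices_front0_face :
  exists t, vertices o sigma = vertices o (front_face o tau 0) ++ t.
Proof.
have [x vx [t vt]] := vertices_front0 tau.
move: fs st (vertices_uniq tau); rewrite !is_faceE vx vt sub1seq.
case: (vertices o sigma) => [|y u]//= xyu; case: eqP => [->|_ yut]; first by exists u.
by rewrite (mem_subseq yut xyu).
Qed.

Lemma join0_drop0 : (0 < dim sigma)%N -> join0 tau (drop_face o sigma 0) = sigma.
Proof.
move=> d0; have [t vs] := vertices_front0_face; have [x vx _] := vertices_front0 tau.
apply: vertices_inj; rewrite /join0 vertices_drop// vs vx/= drop0/=.
by rewrite vertices_span// -[x :: t]/([:: x] ++ t) -vx -vs -is_faceE.
Qed.

Lemma front0_drop0 : (0 < dim sigma)%N ->
  ~~ is_face (front_face o tau 0) (drop_face o sigma 0).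
Proof.
move=> d0; have [t vs] := vertices_front0_face; have [x vx _] := vertices_front0 tau.
rewrite is_faceE vertices_drop// vs vx/= drop0 sub1seq/=.
by have := vertices_uniq sigma; rewrite vs vx/= => /andP[].
Qed.

Lemma front0_dropS i : (i < dim sigma)%N ->
  is_face (front_face o tau 0) (drop_face o sigma i.+1).
Proof.
move=> id; have [t vs] := vertices_front0_face; have [x vx _] := vertices_front0 tau.
by rewrite is_faceE vertices_drop//; [rewrite vs vx/= eqxx sub0seq | exact: leq_ltn_trans id].
Qed.

End Contains.

(** If [sigma] contains the first vertex of [tau], only face 0 of [sigma] misses it, and coning that
    face restores [sigma]. Otherwise face 0 of the cone is [sigma], and its other faces cancel
    against the cones over the faces of [sigma]. *)
Lemma cone_homotopy tau g sigma : is_face sigma tau -> (0 < dim sigma)%N ->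
  zcobound (cone tau g) sigma + cone tau (zcobound g) sigma = g sigma.
Proof.
move=> st d0; rewrite {2}/cone; case de : (dim sigma) d0 => [//|d] _.
rewrite (zcoboundE _ de); case: ifP => vs.
  rewrite addr0 big_nat_recl// big_nat big1 ?addr0 => [|i /andP[_ id]].
    by rewrite expr0 mul1r /cone ifN ?join0_drop0 ?front0_drop0 ?de.
  by rewrite /cone front0_dropS ?mulr0 ?de.
rewrite (@zcoboundE _ _ d.+1); last by rewrite dim_join0 ?de// vs.
rewrite [X in _ + X = _]big_nat_recl// drop_join0// ?vs// expr0 mul1r addrCA -big_split/=.
rewrite big_nat big1 ?addr0// => i /andP[_ id].
rewrite exprS mulN1r mulNr drop_join0S ?vs ?de//.
rewrite /cone ifF ?subrr//; apply/negbTE/negP => fd.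
by rewrite (is_face_trans fd (drop_faceP _ _ _)) in vs.
Qed.

(** In degree 0 the cone contracts only onto the constants: the edge from the first vertex to
    [sigma] contributes both of its ends. *)
Lemma cone_vertex tau g sigma : is_face sigma tau -> dim sigma = 0%N ->
  cone tau (zcobound g) sigma = g sigma - g (front_face o tau 0).
Proof.
move=> st d0; rewrite /cone; case: ifP => vs.
  suff -> : sigma = front_face o tau 0 by rewrite subrr.
  apply: vertices_inj; have [x vx _] := vertices_front0 tau.
  have := size_vertices sigma; move: vs; rewrite is_faceE vx sub1seq d0.
  by case: (vertices o sigma) => [|y []]//; rewrite inE => /eqP ->.
rewrite (@zcoboundE _ _ 0); last by rewrite dim_join0 ?d0// vs.
rewrite !big_nat_recr//= big_geq// add0r mul1r drop_join0 ?vs//.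
by rewrite drop_join01 ?vs// expr1 mulN1r.
Qed.

Lemma cone_faces tau g sigma : is_face sigma tau ->
  cone tau g sigma = \sum_(rho <- faces tau) cone tau (fun x => (x == rho)%:R) sigma * g rho.
Proof.
move=> st; rewrite /cone; case: ifP => vs; first by rewrite big1// => r _; rewrite mul0r.
by rewrite big_seq_delta ?faces_uniq// mem_faces join0_face.
Qed.

Lemma cone_neq0 tau g sigma : is_face sigma tau -> cone tau g sigma != 0 ->
  exists rho, [/\ is_face rho tau, dim rho = (dim sigma).+1 & g rho != 0].
Proof.
rewrite /cone; case: ifP => [|/negbT vs st g0]; first by rewrite eqxx.
by exists (join0 tau sigma); split=> //; [exact: join0_face | exact: dim_join0].
Qed.

Lemma eq_cone tau g g' sigma : is_face sigma tau ->
    (forall rho, is_face rho tau -> g rho = g' rho) ->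
  cone tau g sigma = cone tau g' sigma.
Proof.
move=> st gg'; rewrite /cone; case: ifP => // /negbT vs.
by rewrite gg'//; exact: join0_face.
Qed.

Lemma cone0 tau sigma : cone tau (fun=> 0) sigma = 0.
Proof. by rewrite /cone if_same. Qed.

Lemma star_cobound_exact p q f : f \in pairs p q -> p != 0 -> star_cobound f = 0 ->
  exists2 h, h \in pairs (p - 1) q & star_cobound h = f.
Proof.
move=> fP p0 f0; have /pairsP[fs _] := fP.
exists (fun sigma tau => if is_face sigma tau then cone tau (f^~ tau) sigma else 0).
  apply: (pairs_spread fP) => s t.
    case: ifP => [st /(cone_neq0 st)[r [rt dr /fs[_ rp tq]]]|_]; last by rewrite eqxx.
    by split=> //; lia.
  case: ifP => [st /(cone_neq0 st)[r [rt dr fr]]|_]; last by rewrite eqxx.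
  by exists r, t, t.
apply/funext => s; apply/funext => t; rewrite /star_cobound.
case: ifP => [st|]; last by case: (eqVneq (f s t) 0) => // /fs[->].
rewrite (@eq_zcobound _ (cone t (f^~ t))); last first.
  by move=> r rs _; rewrite (is_face_trans rs st).
case: (posnP (dim s)) => d0.
  rewrite zcobound_dim0//; case: (eqVneq (f s t) 0) => // /fs[_ sp _].
  by rewrite -sp d0 in p0.
rewrite -[RHS](cone_homotopy (f^~ t) st d0) [X in _ = _ + X](@eq_cone _ _ (fun=> 0))//.
  by rewrite cone0 addr0.
by move=> r rt; have := congr1 (fun f => f r t) f0; rewrite /star_cobound rt.
Qed.

Lemma star_cobound_exact0 q f sigma tau : f \in pairs 0 q -> star_cobound f = 0 ->
  is_face sigma tau -> dim sigma = 0%N -> f sigma tau = f (front_face o tau 0) tau.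
Proof.
move=> fP f0 st d0; apply/eqP; rewrite -subr_eq0 -(cone_vertex (f^~ tau) st)//.
rewrite (@eq_cone _ _ (fun=> 0)) ?cone0// => r rt.
by have := congr1 (fun f => f r tau) f0; rewrite /star_cobound rt.
Qed.

(** The transpose of [cone] contracts the augmented chain complex of [tau]. *)
Lemma bound_fst_exact p q f : f \in pairs p q -> bound_fst f = 0 -> augmentation f = 0 ->
  exists2 h, h \in pairs (p + 1) q & bound_fst h = f.
Proof.
move=> fP df0 af0; have /pairsP[fs _] := fP.
pose h rho tau := \sum_(sigma <- faces tau)
  cone tau (fun x => (x == rho)%:R) sigma * f sigma tau.
have hs rho tau : h rho tau != 0 -> exists sigma,
    [/\ is_face rho tau, dim rho = (dim sigma).+1 & f sigma tau != 0].
  move=> h0; apply: contrapT => nex; case/eqP: h0; rewrite /h big_seq.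
  apply: big1 => s; rewrite mem_faces => st.
  apply/eqP; rewrite mulf_eq0; apply/negPn/negP.
  rewrite negb_or => /andP[/(cone_neq0 st)[r [rt dr /=]]].
  case: (eqVneq r rho) => [e _ fst0|//]; by apply: nex; exists s; rewrite -e.
exists h.
  apply: (pairs_spread fP) => r t /hs[s [rt dr f0]]; have [st sp tq] := fs _ _ f0.
    by split=> //; lia.
  by exists s, t, t.
apply/funext => s0; apply/funext => t; rewrite /bound_fst.
case: (boolP (is_face s0 t)) => s0t; last first.
  transitivity (0 : int); last by case: (eqVneq (f s0 t) 0) => // /fs[sot]; rewrite sot in s0t.
  apply: big1 => s _; apply/eqP; rewrite mulf_eq0; apply/negPn/negP.
  rewrite negb_or => /andP[/incidence_neq0[s0s _] /hs[_ [st _ _]]].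
  by rewrite (is_face_trans s0s st) in s0t.
(* The value at [s0] is the pairing with the indicator [g] of [s0], so the claim becomes the
   homotopy formula for [g] paired with [f]. *)
pose g x : int := (x == s0)%:R.
have adj c : (forall r, c r != 0 -> is_face r t) ->
    forall g', \sum_(s <- faces t) zcobound g' s * c s = \sum_(r <- faces t) g' r * zbound c r.
  move=> c0 g'; apply: zcobound_adj; first exact: faces_uniq.
    move=> s r; rewrite !mem_faces => st /incidence_neq0[rs _] _.
    exact: is_face_trans rs st.
  by move=> s r _ _ /c0; rewrite mem_faces.
have deltaE c : \sum_(s <- faces t) g s * c s = c s0.
  rewrite -[RHS](@big_seq_delta _ (faces t)) ?faces_uniq ?mem_faces//.
  by apply: eq_bigr => s _; rewrite /g eq_sym.
rewrite -(deltaE (zbound (h^~ t))) -(deltaE (f^~ t)) -adj; last by move=> r /hs[s []].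
(* The last summand is the defect of the homotopy in degree 0; it adds up to a multiple of
   [augmentation f t], which is 0. *)
rewrite (@eq_big_seq _ _ _ _ _ (fun s => g s * f s t) (fun s => zcobound (cone t g) s * f s t +
    cone t (zcobound g) s * f s t + (if dim s == 0%N then g (front_face o t 0) * f s t else 0))); last first.
  move=> s; rewrite mem_faces => st; case: eqP => d0.
    by rewrite (cone_vertex _ st d0) (zcobound_dim0 _ d0); ring.
  by rewrite addr0 -mulrDl cone_homotopy// lt0n; apply/eqP.
rewrite !big_split/= -[X in _ = _ + X]big_mkcond/= -mulr_sumr.
rewrite -[X in _ = _ + _ * X]/(augmentation f t) (congr1 (fun c => c t) af0) mulr0 addr0.
rewrite [X in _ = X + _]adj; last by move=> r /fs[].
rewrite [X in _ = X + _]big1 ?add0r; last first.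
  by move=> r _; rewrite -[zbound _ r]/(bound_fst f r t) df0 mulr0.
under [RHS]eq_big_seq => s.
  rewrite mem_faces => st; rewrite (cone_faces _ st) mulr_suml; over.
rewrite exchange_big/=; apply: eq_bigr => r _.
by rewrite /h mulr_sumr; apply: eq_bigr => s _; ring.
Qed.

(** The augmentation is the pairing with the 0-cochain 1, which is a cocycle. *)
Lemma augmentation_bound_fst p q f : f \in pairs p q -> augmentation (bound_fst f) = 0.
Proof.
move=> /pairsP[fs _]; apply/funext => t; rewrite /augmentation big_mkcond/=.
pose g (x : simplex X) : int := (dim x == 0%N)%:R.
transitivity (\sum_(s <- faces t) g s * zbound (f^~ t) s).
  by apply: eq_bigr => s _; rewrite /g /bound_fst; case: ifP => _; rewrite ?mul1r ?mul0r.
rewrite -zcobound_adj ?faces_uniq//; last 2 first.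
- move=> s r; rewrite !mem_faces => st /incidence_neq0[rs _] _.
  exact: is_face_trans rs st.
- by move=> s r _ _ /fs[]; rewrite mem_faces.
by apply: big1 => s _; rewrite zcobound_vertices mul0r.
Qed.

Lemma augmentation_cobound_snd p q f : f \in pairs p q -> augmentation (cobound_snd f) = zcobound (augmentation f).
Proof.
move=> /pairsP[fs _]; apply/funext => t; rewrite /augmentation.
under eq_bigr do rewrite /cobound_snd zcobound_faces.
rewrite exchange_big/= [RHS]zcobound_faces; apply: eq_big_seq => r; rewrite mem_faces => rt.
rewrite -mulr_sumr; case: (eqVneq (incidence t r) 0) => [->|i0]; first by rewrite !mul0r.
congr (_ * _); rewrite big_mkcond [RHS]big_mkcond/=.
apply: big_seq_widen; rewrite ?faces_uniq// => s.
case: ifP; rewrite ?eqxx// => _ /fs[sr _ _].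
by rewrite !mem_faces sr (is_face_trans sr rt).
Qed.

Lemma sum_star_delta rho kappa (a : int) :
  \sum_(sigma <- star rho) (kappa == sigma)%:R * (incidence sigma rho * a) =
  zcobound (fun x => (x == rho)%:R * a) kappa.
Proof.
have -> : zcobound (fun x => (x == rho)%:R * a) kappa = incidence kappa rho * a.
  exact: zcoboundMr.
case: (boolP (is_face rho kappa)) => rk.
  by rewrite big_seq_delta ?star_uniq ?mem_star.
rewrite big1_seq => [|s /andP[_]]; last first.
  rewrite mem_star => rs; case: eqP => [e|_]; last by rewrite mul0r.
  by rewrite e rs in rk.
case: (eqVneq (incidence kappa rho) 0) => [->|/incidence_neq0[rk' _]]; first by rewrite mul0r.
by rewrite rk' in rk.
Qed.

(** * Leibniz rules for the cap products *)

Lemma cobound_snd_cap_section m psi : cobound_snd (cap_section m psi) = bound_fst (cap_section m.+1 psi) + cap_section m (zcobound psi) *~ (-1) ^+ m.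
Proof.
apply/funext => s; apply/funext => t.
transitivity (bound_fst (cap_section m.+1 psi) s t + cap_section m (zcobound psi) s t * (-1) ^+ m); last first.
  by congr (_ + _); rewrite !fun_mulz -mulrzr intz.
rewrite /cobound_snd /bound_fst; case: (ltnP m (dim t)) => mt.
  pose F a b : int := (b == s)%:R * psi a.
  rewrite (@eq_zcobound _ (fun r => F (back_face o r m) (front_face o r m))); last first.
    by move=> r rt dr; rewrite /cap_section ifT//; lia.
  rewrite zcobound_cap//; congr (_ + _).
    rewrite -sum_star_delta; apply: eq_bigr => r _; rewrite /cap_section mt; ring.
  rewrite /cap_section (ltnW mt) mulrC; congr (_ * _).
  by rewrite !zcobound_faces mulr_sumr; apply: eq_bigr => r _; rewrite /F; ring.
(* For [dim t <= m] every term is 0: proper faces of [t] have dimension below [m], and a back face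
   at [m] could only be a vertex. *)
rewrite [X in _ = X + _]big1 => [|r _]; last by rewrite /cap_section ltnNge mt mulr0.
rewrite add0r; case: (eqVneq (zcobound (cap_section m psi s) t) 0) => [->|]; last first.
  by move=> /zcobound_neq0[r [rt dr]]; rewrite /cap_section ifF ?eqxx//; lia.
rewrite /cap_section; case: ifP => mt'; rewrite ?mul0r// zcobound_dim0 ?mulr0 ?mul0r//.
by rewrite dim_back//; lia.
Qed.

Lemma cap_pairs_boundary (m : nat) p q f : f \in pairs p q -> q = m%:Z + 1 + p -> 0 <= p ->
  zbound (cap_pairs m.+1 f) = cap_pairs m (star_bound f) - cap_pairs m (star_cobound f) *~ (-1) ^+ m.
Proof.
move=> /pairsP[fs _] qE p0; apply/funext => r.
transitivity (cap_pairs m (star_bound f) r - cap_pairs m (star_cobound f) r * (-1) ^+ m); last first.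
  by congr (_ + _); congr (- _); rewrite !fun_mulz -mulrzr intz.
apply/eqP; rewrite eq_sym subr_eq; apply/eqP.
(* The three terms of [zcobound_cap] for [F t], summed over the star of [r], are the three terms of
   the claim. *)
pose F t a b : int := (b == r)%:R * f a t.
have -> : cap_pairs m (star_bound f) r =
    \sum_(t <- star r) zcobound (fun u => F t (back_face o u m) (front_face o u m)) t.
  rewrite /cap_pairs.
  transitivity (\sum_(u <- star r) \sum_(t <- star r) incidence t u *
      F t (back_face o u m) (front_face o u m)).
    apply: eq_big_seq => u; rewrite mem_star => rk.
    rewrite /star_bound back_faceP (@zbound_seq _ _ (star r)) ?star_uniq//; last first.
      by move=> t /incidence_neq0[kt _] _; rewrite mem_star; exact: is_face_trans kt.
    by rewrite mulr_sumr; apply: eq_bigr => t _; rewrite /F; ring.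
  rewrite exchange_big/=; apply: eq_bigr => t _; rewrite -zcobound_seq ?star_uniq// => u _.
  rewrite /F mem_star; case: (_ =P r) => [<- _|_]; first exact: front_faceP.
  by rewrite mul0r eqxx.
have -> : cap_pairs m (star_cobound f) r * (-1) ^+ m = \sum_(t <- star r)
    (-1) ^+ m * zcobound ((F t)^~ (front_face o t m)) (back_face o t m).
  rewrite mulrC mulr_sumr; apply: eq_bigr => t _; congr (_ * _).
  rewrite /star_cobound back_faceP /F !zcobound_faces mulr_sumr.
  by apply: eq_bigr => u _; ring.
have -> : zbound (cap_pairs m.+1 f) r = \sum_(t <- star r)
    zcobound (F t (back_face o t m.+1)) (front_face o t m.+1).
  rewrite /zbound.
  transitivity (\sum_(u <- star r) \sum_(t <- star r)
      (front_face o t m.+1 == u)%:R * (incidence u r * f (back_face o t m.+1) t)).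
    apply: eq_big_seq => u; rewrite mem_star => rk.
    rewrite /cap_pairs mulr_sumr [LHS](@big_seq_widen _ _ _ (star r)) ?star_uniq//.
      by apply: eq_bigr => t _; ring.
    move=> t; rewrite !mem_star; case: (_ =P u) => [e _|_]; last by rewrite !(mul0r, mulr0) eqxx.
    have ut : is_face u t by rewrite -e front_faceP.
    by rewrite ut (is_face_trans rk ut).
  by rewrite exchange_big/=; apply: eq_bigr => t _; rewrite sum_star_delta.
rewrite -big_split/=; apply: eq_bigr => t _.
case: (ltnP m (dim t)) => mt; first exact: zcobound_cap.
have F0 a b : F t a b = 0.
  rewrite /F; case: (eqVneq (f a t) 0) => [->|/fs[_ ap tq]]; first by rewrite mulr0.
  by lia.
by rewrite !zcobound_faces !big1 ?mulr0 ?addr0// => u _; rewrite F0 mulr0.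
Qed.

(** * Local homology as exactness on stars *)

Notation ZC := (const_cosheaf X).
Notation ZS := (const_sheaf X).
Implicit Types (b : simplex X -> int).

(** The complex [C(X, X - st sigma)] is free on the simplices of the star of
    [sigma], with differential [zbound] followed by restriction to the star. *)
Definition star_exact (n : nat) := forall sigma q c, q != n%:Z ->
    (forall tau, c tau != 0 -> is_face sigma tau /\ (dim tau)%:Z = q) ->
    (forall rho, is_face sigma rho -> zbound c rho = 0) ->
  exists2 b, forall tau, b tau != 0 -> is_face sigma tau /\ (dim tau)%:Z = q + 1 &
    forall rho, is_face sigma rho -> zbound b rho = c rho.

Lemma mem_dsum_chains k c : ((c : sections ZC) \in dsum ZC k) = (c \in chains k).
Proof.
apply/dsumP/chainsP => -[ck cf]; split.
- by move=> s /eqP cs; apply: contrapT => /ck.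
- by apply: sub_finite_set cf => s /= /eqP.
- by move=> s sk; apply/eqP/negPn/negP => /ck.
- by apply: sub_finite_set cf => s /= /eqP.
Qed.

Lemma mem_dsum_cochains k c : ((c : sections ZS) \in dsum ZS k) = (c \in chains k).
Proof. exact: mem_dsum_chains. Qed.

Lemma bound_const (c : simplex X -> int) : @bound V X o ZC c = zbound c.
Proof.
apply/funext => tau; rewrite boundE fsbig_finite; last exact: finite_star.
apply: eq_bigr => s _; rewrite /incidence /zcobound mulr_suml; apply: eq_bigr => i _.
by rewrite (single_const (M := int)) -mulrzr intz -mulr_natr /=; ring.
Qed.

Lemma cobound_const (c : simplex X -> int) : @cobound V X o ZS c = zcobound c.
Proof.
by apply/funext => tau; apply: eq_bigr => i _; rewrite /= -mulrzr intz mulrC.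
Qed.

Lemma zbound_chains k c : c \in chains k -> zbound c \in chains (k - 1).
Proof.
move=> /chainsP[ck cf]; apply/chainsP; split.
  by move=> r /zbound_neq0[s [rs ds /ck]]; lia.
apply: (@sub_finite_set _ _ (\bigcup_(s in [set s | c s != 0]) [set r | is_face r s])%classic).
  by move=> r /zbound_neq0[s [rs _ cs]]; exists s.
by apply: bigcup_finite => // s _; exact: finite_faces.
Qed.

Definition restrict sigma c tau : int := if is_face sigma tau then c tau else 0.

Lemma star_chains sigma k c :
    (forall tau, c tau != 0 -> is_face sigma tau /\ (dim tau)%:Z = k) ->
  c \in chains k.
Proof.
move=> c0; apply/chainsP; split=> [t /c0[]//|].
by apply: sub_finite_set (finite_star sigma) => t /c0[].
Qed.

Lemma restrict_neq0 sigma k c tau : c \in chains k -> restrict sigma c tau != 0 ->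
  is_face sigma tau /\ (dim tau)%:Z = k.
Proof.
move=> /chainsP[ck _]; rewrite /restrict; case: ifP => [st /ck//|]; by rewrite eqxx.
Qed.

Lemma restrict_chains sigma k c : c \in chains k -> restrict sigma c \in chains k.
Proof. by move=> ck; apply: (star_chains (sigma := sigma)) => t; exact: restrict_neq0. Qed.

Lemma off_star_chains sigma k c : c \in chains k ->
    (forall rho, is_face sigma rho -> c rho = 0) ->
  (c : sections ZC) \in off_star sigma k.
Proof. by move=> ck c0; apply/off_starP; rewrite mem_dsum_chains. Qed.

Lemma restrict_off_star sigma k c : c \in chains k ->
  ((c - restrict sigma c)%R : sections ZC) \in off_star sigma k.
Proof.
move=> ck; apply: off_star_chains; first by rewrite rpredB// restrict_chains.
by move=> r sr; rewrite [LHS]/(c r - restrict sigma c r) /restrict sr; exact: subrr.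
Qed.

Lemma zbound_restrict sigma c rho : is_face sigma rho -> zbound (restrict sigma c) rho = zbound c rho.
Proof. by move=> sr; apply: eq_zbound => t rt; rewrite /restrict (is_face_trans sr rt). Qed.

Notation loc_cycles k sigma :=
  (rel_ker_on (@bound V X o ZC) (dsum ZC k) (off_star sigma (k - 1))).
Notation loc_boundaries k sigma :=
  (rel_im_on (@bound V X o ZC) (dsum ZC (k + 1)) (off_star sigma k)).

Lemma mem_loc_cycles k sigma c : c \in chains k ->
    (forall rho, is_face sigma rho -> zbound c rho = 0) ->
  (c : sections ZC) \in loc_cycles k sigma.
Proof.
move=> ck c0; rewrite rel_ker_onE mem_dsum_chains ck/= bound_const.
by apply: off_star_chains => //; exact: zbound_chains.
Qed.

Lemma loc_hom_rep k sigma c (x : loc_hom o k sigma) : represents (c : sections ZC) x ->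
  c \in chains k /\ forall rho, is_face sigma rho -> zbound c rho = 0.
Proof.
move=> /represents_cycle; rewrite rel_ker_onE mem_dsum_chains/= bound_const.
by move=> /andP[-> /off_starP[_ c0]].
Qed.

(** Dropping the simplices off the star changes a relative cycle by a chain of the subcomplex, which
    is zero in the quotient. *)
Lemma loc_hom_restrict k sigma c (x : loc_hom o k sigma) :
  represents (c : sections ZC) x -> represents (restrict sigma c : sections ZC) x.
Proof.
move=> cx; have [ck c0] := loc_hom_rep cx.
apply: (represents_congr cx).
  apply/rel_im_onP; exists 0, (c - restrict sigma c : simplex X -> int)%R.
  by rewrite rpred0 raddf0 add0r; split=> //; exact: restrict_off_star.
apply: mem_loc_cycles; first exact: restrict_chains.
by move=> r sr; rewrite zbound_restrict// c0.
Qed.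

Lemma star_exact_CM (n : nat) : locally_CM o n -> star_exact n.
Proof.
move=> CM sigma q c qn cs c0.
have ck := star_chains cs.
have [x cx] := represents_ex (loc_boundaries q sigma) (mem_loc_cycles ck c0).
have x0 : x = 0 by apply: CM; apply/eqP.
have /rel_im_onP[y [a [yk /off_starP[_ a0] cyE]]] := (represents_eq0 cx).1 x0.
rewrite mem_dsum_chains in yk.
exists (restrict sigma y); first by move=> t; exact: restrict_neq0.
move=> r sr; rewrite zbound_restrict//.
have -> : c r = bound o y r + a r by rewrite cyE.
by rewrite a0// addr0 bound_const.
Qed.

(** * Exactness in the second variable *)

Section Duality.
Variable n : nat.
Hypothesis exactX : star_exact n.

(** The star of [sigma] is finite, so it has a simplex [tau] of maximal dimension, which has no
    proper coface. The indicator of [tau] is then a local cycle but no boundary, and exactness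
    forces [dim tau = n]. *)
Lemma dim_le sigma : (dim sigma <= n)%N.
Proof.
pose P m := has (fun tau => dim tau == m) (star sigma).
have [m Pm m_max] : exists2 m, P m & forall m', P m' -> (m' <= m)%N.
  have exP : exists m, P m.
    by exists (dim sigma); apply/hasP; exists sigma; rewrite ?mem_star ?is_face_refl.
  have ubP m : P m -> (m <= \sum_(tau <- star sigma) dim tau)%N.
    move=> /hasP[tau ts /eqP <-].
    by rewrite (bigD1_seq tau) ?star_uniq//= leq_addr.
  by have [m Pm m_max] := ex_maxnP exP ubP; exists m.
have /hasP[tau] := Pm; rewrite mem_star => st /eqP tm.
have top rho : is_face tau rho -> rho = tau.
  move=> tr; apply/esym/(is_face_eq tr)/eqP; rewrite eqn_leq is_face_dim//= tm m_max//.
  by apply/hasP; exists rho; rewrite ?mem_star ?(is_face_trans st tr).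
suff <- : dim tau = n by exact: is_face_dim.
apply/eqP/negPn/negP => tn.
pose c rho : int := (rho == tau)%:R.
have [||| b b0 bc] := @exactX tau (dim tau) c => //.
- by move=> rho; rewrite /c; case: (rho =P tau) => [->|//]; rewrite is_face_refl.
- move=> rho /top ->; apply: big1 => s _.
  apply/eqP; rewrite mulf_eq0; apply/negPn/negP; rewrite negb_or /c.
  by case: (s =P tau) => [->|_] /andP[]// /incidence_neq0[_]; lia.
have := bc tau (is_face_refl tau); rewrite /c eqxx /zbound big1// => s _.
apply/eqP; rewrite mulf_eq0; apply/negPn/negP; rewrite negb_or => /andP[_ /b0[/top e ds]].
by rewrite e in ds; lia.
Qed.

Lemma star_bound_exact p q f : f \in pairs p q -> q != n%:Z -> star_bound f = 0 ->
  exists2 h, h \in pairs p (q + 1) & star_bound h = f.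
Proof.
move=> fP qn f0; have /pairsP[fs _] := fP.
(* The third condition makes the preimage 0 over every [sigma] with [f sigma = 0], whence its finite
   support. *)
have rowP sigma : exists b, (forall tau, b tau != 0 ->
    [/\ is_face sigma tau, (dim tau)%:Z = q + 1 & exists tau', f sigma tau' != 0]) /\
    forall rho, is_face sigma rho -> zbound b rho = f sigma rho.
  have [nz|z] := pselect (exists tau, f sigma tau != 0).
    have [| |b b0 bf] := @exactX sigma q (f sigma) qn.
    - by move=> tau /fs[].
    - by move=> rho sr; have := congr1 (fun f => f sigma rho) f0; rewrite /star_bound sr.
    by exists b; split=> // tau /b0[].
  exists 0; split=> [tau /eqP[]//|rho _].
  rewrite raddf0; apply/esym/eqP/negPn/negP => fr; by apply: z; exists rho.
have [h hP] := choice rowP; exists h.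
  apply: (pairs_spread fP) => s t /(proj1 (hP s))[st tq [t' ft']].
    by have [_ sp _] := fs _ _ ft'.
  by exists s, t', s; split=> //; exact: is_face_refl.
apply/funext => s; apply/funext => r; rewrite /star_bound; case: ifP => sr.
  by rewrite (proj2 (hP s)).
by case: (eqVneq (f s r) 0) => // /fs[]; rewrite sr.
Qed.

(** As the complex [C(X, X - st sigma)] consists of free groups, its exactness
    below degree [n] yields a contraction, which can be transposed. *)
Lemma star_contraction sigma N : (N <= n)%N -> exists k : simplex X -> simplex X -> int,
  (forall tau rho, k tau rho != 0 -> is_face sigma rho /\ dim rho = (dim tau).+1) /\
  forall tau rho, is_face sigma tau -> (dim tau < N)%N -> is_face sigma rho ->
    zbound (k tau) rho + \sum_(kappa <- star sigma) incidence tau kappa * k kappa rho =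
    (tau == rho)%:R.
Proof.
elim: N => [|N IH] Nn; first by exists 0; split=> [t r /eqP[]|].
have [k [k0 kP]] := IH (ltnW Nn).
(* What remains of [tau] after contracting its boundary. This is a relative cycle, and a chain that
   it bounds defines the contraction in degree [N]. *)
pose c tau rho := (tau == rho)%:R - \sum_(kappa <- star sigma) incidence tau kappa * k kappa rho.
have colP tau : exists b, (forall rho, b rho != 0 -> is_face sigma rho /\ dim rho = (dim tau).+1) /\
    (is_face sigma tau -> dim tau = N -> forall rho, is_face sigma rho -> zbound b rho = c tau rho).
  have [[st tN]|ntau] := pselect (is_face sigma tau /\ dim tau = N); last first.
    by exists 0; split=> [t /eqP[]//|st tN]; case: ntau.
  have [| | |b b0 bc] := @exactX sigma (dim tau) (c tau).
  - by lia.
  - move=> r; rewrite /c; case: (tau =P r) => [<- //|_]; rewrite sub0r oppr_eq0 => s0.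
    apply: contrapT => nex; case/eqP: s0; apply: big1 => u _.
    apply/eqP; rewrite mulf_eq0; apply/negPn/negP.
    by rewrite negb_or => /andP[/incidence_neq0[_ du] /k0[sr dr]]; apply: nex; split=> //; lia.
  - move=> r sr; rewrite /zbound.
    transitivity (incidence tau r - \sum_(u <- star sigma) incidence tau u * zbound (k u) r).
      under eq_bigr do rewrite mulrBr.
      rewrite sumrB; congr (_ - _); last first.
        under eq_bigr do rewrite mulr_sumr.
        rewrite exchange_big/=; apply: eq_bigr => u _; rewrite /zbound mulr_sumr.
        by apply: eq_bigr => x _; ring.
      case: (boolP (is_face r tau)) => rt.
        rewrite -[RHS](@big_seq_delta _ (star r) (incidence^~ r)) ?star_uniq ?mem_star//.
        by apply: eq_bigr => x _; rewrite mulrC.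
      rewrite big1_seq => [|x /andP[_]]; last first.
        by rewrite mem_star; case: eqP => [<-|_]; [rewrite (negPf rt) | rewrite mulr0].
      by case: (eqVneq (incidence tau r) 0) => // /incidence_neq0[]; rewrite (negPf rt).
    apply/eqP; rewrite subr_eq0; apply/eqP.
    (* By induction [zbound (k u)] is [u] minus the contraction of its boundary; the latter parts
       sum to 0, as the boundary of a boundary vanishes. *)
    transitivity (\sum_(u <- star sigma) (incidence tau u * (u == r)%:R -
       incidence tau u * \sum_(l <- star sigma) incidence u l * k l r)); last first.
      apply: eq_big_seq => u; rewrite mem_star => su; rewrite -mulrBr.
      case: (eqVneq (incidence tau u) 0) => [->|/incidence_neq0[_ du]]; first by rewrite !mul0r.
      by rewrite -kP ?addrK//; lia.
    rewrite sumrB [X in _ - X](_ : _ = 0) ?subr0.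
      rewrite -[LHS](@big_seq_delta _ (star sigma)) ?star_uniq ?mem_star//.
      by apply: eq_bigr => u _; rewrite mulrC eq_sym.
    under eq_bigr do rewrite mulr_sumr.
    rewrite exchange_big/= big1_seq// => l /andP[_]; rewrite mem_star => sl.
    under eq_bigr do rewrite mulrA.
    rewrite -mulr_suml -zcobound_seq ?zcobound_incidence ?mul0r ?star_uniq// => u _ /incidence_neq0[lu _].
    by rewrite mem_star; exact: is_face_trans lu.
  exists b; split=> [r /b0[]|_ _ //]; first by split=> //; lia.
have [b bP] := choice colP.
exists (fun tau => if dim tau == N then b tau else k tau); split.
  by move=> t r; case: ifP => _; [move/(proj1 (bP t)) | move/k0].
move=> t r st; rewrite ltnS leq_eqVlt => tN sr.
rewrite (@eq_big_seq _ _ _ _ _ _ (fun u => incidence t u * k u r)); last first.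
  move=> u _; case: (eqVneq (incidence t u) 0) => [->|/incidence_neq0[_ du]]; first by rewrite !mul0r.
  by rewrite ifF//; lia.
case: eqP tN => [tN _|_ /= tN]; last exact: kP.
by rewrite (proj2 (bP t))// /c subrK.
Qed.

(** The bound [q < n] is the range of the contraction; at [q = n] the cokernel is [h^n]. *)
Lemma cobound_snd_exact p q f : f \in pairs p q -> q < n%:Z -> cobound_snd f = 0 ->
  exists2 h, h \in pairs p (q - 1) & cobound_snd h = f.
Proof.
move=> fP qn f0; have /pairsP[fs _] := fP.
have [k kP] := choice (fun sigma => star_contraction sigma (leqnn n)).
pose h sigma rho : int := if is_face sigma rho then
  \sum_(tau <- star sigma) k sigma rho tau * f sigma tau else 0.
have hs sigma rho : h sigma rho != 0 -> exists tau,
    [/\ is_face sigma rho, dim tau = (dim rho).+1 & f sigma tau != 0].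
  rewrite /h; case: ifP => [sr h0|_]; last by rewrite eqxx.
  apply: contrapT => nex; case/eqP: h0; apply: big1 => t _.
  apply/eqP; rewrite mulf_eq0; apply/negPn/negP; rewrite negb_or.
  by move=> /andP[/(proj1 (kP sigma))[_ dt] ft]; apply: nex; exists t.
exists h.
  apply: (pairs_spread fP) => s r /hs[t [sr dt ft]]; have [st sp tq] := fs _ _ ft.
    by split=> //; lia.
  by exists s, t, s; split=> //; exact: is_face_refl.
apply/funext => s; apply/funext => t; rewrite /cobound_snd.
case: (boolP (is_face s t && (dim t < n)%N)) => [/andP[st tn]|nst]; last first.
  case: (eqVneq (zcobound (h s) t) 0) => [->|].
    case: (eqVneq (f s t) 0) => // /fs[st sp tq].
    by rewrite st/= in nst; lia.
  move=> /zcobound_neq0[r [rt dt /hs[u [sr du /fs[su sp uq]]]]].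
  by rewrite (is_face_trans sr rt)/= in nst; lia.
rewrite -[RHS](@big_seq_delta _ (star s) (f s)) ?star_uniq ?mem_star//.
(* The homotopy formula replaces [(t == r)%:R]. Its boundary term, moved over to [f s] by
   adjunction, vanishes because [f s] is a cocycle; the other term is the coboundary of [h s]. *)
rewrite [RHS](@eq_big_seq _ _ _ _ _ _ (fun r => f s r * zbound (k s t) r +
   \sum_(u <- star s) incidence t u * (k s u r * f s r))); last first.
  move=> r; rewrite mem_star => sr; rewrite -(proj2 (kP s))// mulrDl mulr_suml mulrC.
  by congr (_ + _); apply: eq_bigr => u _; rewrite mulrA.
rewrite big_split/= -zcobound_adj ?star_uniq//; last 2 first.
- by move=> u v _ _ /fs[]; rewrite mem_star.
- by move=> u v; rewrite !mem_star => sv /incidence_neq0[vu _] _; exact: is_face_trans vu.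
rewrite [X in _ = X + _]big1 ?add0r => [|r _]; last first.
  by rewrite -[zcobound _ r]/(cobound_snd f s r) f0 mul0r.
rewrite exchange_big/= (@zcobound_seq _ _ (star s)) ?star_uniq//; last first.
  by move=> r _ /hs[u [sr _ _]]; rewrite mem_star.
by apply: eq_big_seq => u; rewrite mem_star => su; rewrite -mulr_sumr /h su.
Qed.

Lemma front_full tau m : dim tau = m -> front_face o tau m = tau.
Proof. by move=> tm; apply: (is_face_eq (front_faceP o tau m)); rewrite dim_front ?tm. Qed.

Lemma back0 tau : back_face o tau 0 = tau.
Proof. by apply: vertices_inj; rewrite vertices_back// drop0. Qed.

(** * Staircases *)

(** The inclusion of [C_q(X; Z)] as the kernel of [star_cobound] at [p = 0]. *)
Definition vertex_sum c sigma tau : int :=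
  if is_face sigma tau && (dim sigma == 0%N) then c tau else 0.

Lemma vertex_sum_pairs k c : c \in chains k -> vertex_sum c \in pairs 0 k.
Proof.
move=> ck; have /chainsP[c0 _] := ck; apply: (chains_to_pairs ck) => s t; rewrite /vertex_sum.
  by case: ifP => [/andP[st /eqP ->] /c0//|]; rewrite eqxx.
case: ifP => [/andP[st _] ct|]; last by rewrite eqxx.
by exists t, t; split=> //; exact: is_face_refl.
Qed.

Lemma star_bound_vertex_sum c : star_bound (vertex_sum c) = vertex_sum (zbound c).
Proof.
apply/funext => s; apply/funext => r; rewrite /star_bound {2}/vertex_sum; case: ifP => sr //=.
case: eqP => s0; last first.
  by rewrite /zbound big1// => t _; rewrite /vertex_sum; case: eqP s0 => //; rewrite andbF mulr0.
by apply: eq_zbound => t rt; rewrite /vertex_sum (is_face_trans sr rt) s0.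
Qed.

Lemma star_cobound_vertex_sum c : star_cobound (vertex_sum c) = 0.
Proof.
apply/funext => s; apply/funext => t; rewrite /star_cobound; case: ifP => // st.
rewrite (@eq_zcobound _ (fun x => (dim x == 0%N)%:R * c t)).
  by rewrite zcoboundMr zcobound_vertices mul0r.
move=> r rs _; rewrite /vertex_sum (is_face_trans rs st)/=.
by case: ifP => _; rewrite ?mul1r ?mul0r.
Qed.

(** The support of [f] lies over [m]-simplices, which are their own front faces, so one summand
    survives. *)
Lemma cap_pairs_vertex m f rho : f \in pairs 0 m%:Z -> cap_pairs m f rho = f (back_face o rho m) rho.
Proof.
move=> /pairsP[fs _].
rewrite -[RHS](@big_seq_delta _ (star rho) (fun t => f (back_face o t m) t)) ?star_uniq//; last first.
  by rewrite mem_star is_face_refl.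
apply: eq_bigr => t _; case: (eqVneq (f (back_face o t m) t) 0) => [->|].
  by rewrite !mulr0.
by move=> /fs[_ _ tm]; rewrite front_full ?[t == _]eq_sym//; lia.
Qed.

Lemma cap_pairs_vertex_sum m c : c \in chains m%:Z -> cap_pairs m (vertex_sum c) = c.
Proof.
move=> cm; have /chainsP[c0 _] := cm; apply/funext => r.
rewrite cap_pairs_vertex ?vertex_sum_pairs// /vertex_sum back_faceP.
case: (eqVneq (c r) 0) => [->|/c0 rm]; first by rewrite if_same.
by rewrite dim_back ?ifT//; lia.
Qed.

Lemma vertex_sum_cap_pairs m f : f \in pairs 0 m%:Z -> star_cobound f = 0 -> f = vertex_sum (cap_pairs m f).
Proof.
move=> fP f0; have /pairsP[fs _] := fP.
apply/funext => s; apply/funext => t; rewrite /vertex_sum cap_pairs_vertex//.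
case: ifP => [/andP[st /eqP s0]|nst]; last first.
  case: (eqVneq (f s t) 0) => // /fs[st s0 tm].
  by rewrite st/= in nst; lia.
rewrite (star_cobound_exact0 fP f0 st s0).
case: (eqVneq (dim t) m) => tm.
  by rewrite (star_cobound_exact0 fP f0 (back_faceP o t m)) ?dim_back ?tm ?subnn.
have f0t x : f x t = 0 by case: (eqVneq (f x t) 0) => // /fs[_ _]; lia.
by rewrite !f0t.
Qed.

(** Starting at [p = 0] this gives surjectivity of the first cap product. A step replaces
    [f = star_bound h] by [star_cobound h], up to sign; by [cap_pairs_boundary] the two caps differ
    by a boundary. *)
Lemma lift_cycle j m p q f : f \in pairs p q -> 0 <= p -> q = m%:Z + p -> q + j%:Z = n%:Z ->
    star_bound f = 0 -> star_cobound f = 0 ->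
  exists phi, [/\ phi \in pairs (p + j%:Z) n%:Z, star_bound phi = 0, star_cobound phi = 0 &
    exists2 b, b \in chains (m%:Z + 1) & cap_pairs m f - cap_pairs m phi = zbound b].
Proof.
elim: j p q f => [|j IH] p q f fP p0 qE qn df cf.
  exists f; split=> //; first by rewrite addr0 -qn addr0.
  by exists 0; rewrite ?rpred0// subrr raddf0.
have [|h hP hf] := star_bound_exact fP _ df; first by lia.
have [| | | | | |phi [phiP dphi cphi [b bP bE]]] := IH (p + 1) (q + 1) (star_cobound h *~ (-1) ^+ m).
- by rewrite rpredMz// star_cobound_pairs.
- by lia.
- by lia.
- by lia.
- by rewrite raddfMz/= star_bound_cobound hf cf mul0rz.
- by rewrite raddfMz/= star_coboundK mul0rz.
exists phi; split=> //.
  by have -> : p + j.+1%:Z = p + 1 + j%:Z by lia.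
exists (cap_pairs m.+1 h + b).
  rewrite rpredD//; have -> : m%:Z + 1 = m.+1%:Z by lia.
  by apply: (cap_pairs_chains hP) => //; lia.
rewrite raddfD/= -bE (cap_pairs_boundary hP)//; last by lia.
by rewrite hf (raddfMz (cap_pairs m)) addrA subrK.
Qed.

Lemma descend_boundary0 m f c : f \in pairs 0 m%:Z -> star_cobound f = 0 ->
    c \in chains (m%:Z + 1) -> cap_pairs m f = zbound c ->
  exists h, [/\ h \in pairs 0 (m%:Z + 1), star_cobound h = 0 & star_bound h = f].
Proof.
move=> fP f0 cP fc; exists (vertex_sum c); split; [exact: vertex_sum_pairs | exact: star_cobound_vertex_sum |].
by rewrite star_bound_vertex_sum -fc -vertex_sum_cap_pairs.
Qed.

(** At [q = n] this is injectivity of the first cap product. If [star_cobound h = f], then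
    [star_bound h] lies one step lower and its cap is again a boundary by [cap_pairs_boundary]; the
    solution found there corrects [h]. *)
Lemma descend_boundary (p m : nat) q f c : f \in pairs p.+1%:Z q -> q = m%:Z + p.+1%:Z -> q <= n%:Z ->
    star_bound f = 0 -> star_cobound f = 0 -> c \in chains (m%:Z + 1) -> cap_pairs m f = zbound c ->
  exists h, [/\ h \in pairs p%:Z q, star_cobound h = f & star_bound h = 0].
Proof.
elim: p m q f c => [|p IH] m q f c fP qE qn df cf cP fc.
all: have [|h hP hf] := star_cobound_exact fP _ cf; first by lia.
all: have := cap_pairs_boundary (m := m) hP; rewrite hf fc => capE.
all: have eP := star_bound_pairs hP.
  have [||||g [gP cg dg]] := @descend_boundary0 m (star_bound h) (cap_pairs m.+1 h + c *~ (-1) ^+ m).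
  - by have <- : q - 1 = m%:Z by lia.
  - by rewrite -star_bound_cobound hf.
  - rewrite rpredD ?rpredMz//; have -> : m%:Z + 1 = m.+1%:Z by lia.
    by apply: (cap_pairs_chains hP); lia.
  - by rewrite raddfD/= (raddfMz zbound) capE ?subrK//; lia.
  exists (h - g); split; last 2 first.
  - by rewrite raddfB/= hf cg subr0.
  - by rewrite raddfB/= dg subrr.
  by rewrite rpredB//; have -> : q = m%:Z + 1 by lia.
have pE : p.+2%:Z - 1 = p.+1%:Z by lia.
rewrite pE in hP eP.
have [||||||h' [h'P ch' dh']] := IH m (q - 1) (star_bound h) (cap_pairs m.+1 h + c *~ (-1) ^+ m) eP.
- by lia.
- by lia.
- exact: star_boundK.
- by rewrite -star_bound_cobound hf.
- rewrite rpredD ?rpredMz//; have -> : m%:Z + 1 = m.+1%:Z by lia.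
  by apply: (cap_pairs_chains hP); lia.
- by rewrite raddfD/= (raddfMz zbound) capE ?subrK//; lia.
(* Since [q - 1 < n], [h'] is some [star_bound u]; subtracting [star_cobound u] removes
   [star_bound h] and keeps [star_cobound h]. *)
have [|u uP du] := star_bound_exact h'P _ dh'; first by lia.
exists (h - star_cobound u); split; last 2 first.
- by rewrite raddfB/= hf star_coboundK subr0.
- by rewrite raddfB/= star_bound_cobound du ch' subrr.
rewrite rpredB//; have -> : p.+1%:Z = p%:Z + 1 by lia.
by apply: star_cobound_pairs; have <- : q - 1 + 1 = q by lia.
Qed.

(** * Staircases for the second cap product *)

Lemma augmentation_cap_section psi : augmentation (cap_section 0 psi) = psi.
Proof.
apply/funext => t; rewrite /augmentation big_mkcond/=.
transitivity (\sum_(s <- faces t) (front_face o t 0 == s)%:R * psi t); last first.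
  by rewrite big_seq_delta ?faces_uniq// mem_faces front_faceP.
apply: eq_bigr => s _; rewrite /cap_section leq0n back0.
case: (_ =P s) => [<-|_]; first by rewrite dim_front.
by rewrite mul0r if_same.
Qed.

Lemma cap_section_cocycle m psi : zcobound psi = 0 -> cobound_snd (cap_section m psi) = bound_fst (cap_section m.+1 psi).
Proof. by move=> p0; rewrite cobound_snd_cap_section p0 raddf0 mul0rz addr0. Qed.

(** At [q = n] this is injectivity of the second cap product: the last equation says that the cap is
    a boundary modulo coboundaries. The equation passes from [m] to [m - 1] with [bound_fst h] as
    its boundary term, and at [m = 0] the augmentation turns it into [psi = zcobound chi]. *)
Lemma descend_coboundary m p q psi (g h : simplex X -> simplex X -> int) : psi \in chains p -> 0 <= p -> zcobound psi = 0 ->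
    q = m%:Z + p -> q <= n%:Z -> g \in pairs (m%:Z + 1) q -> h \in pairs m%:Z (q - 1) ->
    cap_section m psi = bound_fst g + cobound_snd h ->
  exists2 chi, chi \in chains (p - 1) & zcobound chi = psi.
Proof.
move=> pP p0 cp; elim: m q g h => [|m IH] q g h qE qn gP hP sg.
  exists (augmentation h); first by apply: augmentation_chains; have <- : q - 1 = p - 1 by lia.
  by rewrite -(augmentation_cobound_snd hP) -[RHS]augmentation_cap_section sg raddfD/= (augmentation_bound_fst gP) add0r.
have dh : bound_fst h \in pairs m%:Z (q - 1).
  by have := bound_fst_pairs hP; have -> : m.+1%:Z - 1 = m%:Z by lia.
have [| | |h' h'P h'E] := cobound_snd_exact (p := m%:Z) (q := q - 1) (f := cap_section m psi - bound_fst h).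
- rewrite rpredB//; have -> : q - 1 = m%:Z + p by lia.
  exact: cap_section_pairs.
- by lia.
- by rewrite raddfB/= cap_section_cocycle// sg raddfD/= bound_fstK add0r cobound_snd_bound_fst subrr.
apply: (IH (q - 1) h h') => //; try lia.
- by have -> : m%:Z + 1 = m.+1%:Z by lia.
- by rewrite h'E addrC subrK.
Qed.

(** At [q = n] this is surjectivity of the second cap product. [y] witnesses that [z] is a cycle
    modulo coboundaries; it satisfies the hypotheses one step lower with [z] in the role of [w], and
    its decomposition yields that of [z]. *)
Lemma lift_cocycle m q z y w : 0 <= q - m%:Z -> q <= n%:Z ->
    z \in pairs m%:Z q -> y \in pairs (m%:Z - 1) (q - 1) -> w \in pairs (m%:Z + 1) (q + 1) ->
    bound_fst z = cobound_snd y -> cobound_snd z = bound_fst w ->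
  exists psi (g h : simplex X -> simplex X -> int), [/\ psi \in chains (q - m%:Z), zcobound psi = 0,
    g \in pairs (m%:Z + 1) q, h \in pairs m%:Z (q - 1) & z = cap_section m psi + bound_fst g + cobound_snd h].
Proof.
elim: m q z y w => [|m IH] q z y w qm qn zP yP wP dz cz.
  have pz : augmentation z \in chains q by exact: augmentation_chains.
  have sz : cap_section 0 (augmentation z) \in pairs 0 q.
    by have := cap_section_pairs 0 pz; rewrite add0r; apply; rewrite subr0 in qm.
  have [| | |g gP gE] := bound_fst_exact (p := 0) (q := q) (f := z - cap_section 0 (augmentation z)).
  - exact: rpredB.
  - have pairs_m1 f q' : f \in pairs (-1) q' -> f = 0.
      move=> /pairsP[fs _]; apply/funext => s; apply/funext => t.
      by apply/eqP/negPn/negP => /fs[]; lia.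
    apply: (@pairs_m1 _ q).
    by have := bound_fst_pairs (rpredB zP sz); rewrite sub0r.
  - by rewrite raddfB/= augmentation_cap_section subrr.
  exists (augmentation z), g, 0; split=> //; rewrite ?subr0 ?rpred0//.
    by rewrite -(augmentation_cobound_snd zP) cz (augmentation_bound_fst wP).
  by rewrite gE raddf0 addr0 addrC subrK.
have dyP : bound_fst y \in pairs (m%:Z - 1) (q - 1).
  by have := bound_fst_pairs yP; have -> : m.+1%:Z - 1 = m%:Z by lia.
have [| |y' y'P y'E] := cobound_snd_exact dyP; first by lia.
  by rewrite cobound_snd_bound_fst -dz bound_fstK.
have [| | | | | | |psi [g [h [pP cp gP hP yE]]]] := IH (q - 1) y y' z.
- by lia.
- by lia.
- by have <- : m.+1%:Z - 1 = m%:Z by lia.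
- by [].
- by rewrite subrK; have -> : m%:Z + 1 = m.+1%:Z by lia.
- by rewrite y'E.
- by rewrite dz.
have mE : m%:Z + 1 = m.+1%:Z by lia.
have pE : q - 1 - m%:Z = q - m.+1%:Z by lia.
rewrite mE in gP; rewrite pE in pP.
(* Subtracting [cobound_snd g] compensates the part [bound_fst g] of [y], so that the difference is
   a cycle for [bound_fst]. *)
have zsP : z - cap_section m.+1 psi - cobound_snd g \in pairs m.+1%:Z q.
  rewrite !rpredB//.
    by have := cap_section_pairs m.+1 pP qm; have -> : m.+1%:Z + (q - m.+1%:Z) = q by lia.
  by have := cobound_snd_pairs gP; have -> : q - 1 + 1 = q by lia.
have [| |u uP uE] := bound_fst_exact zsP.
- by rewrite !raddfB/= dz yE !raddfD/= cobound_sndK addr0 cobound_snd_bound_fst cap_section_cocycle// -addrA -opprD subrr.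
- have /pairsP[zs _] := zsP; apply/funext => t; apply: big1 => s /eqP s0.
  by apply/eqP/negPn/negP => /zs[]; lia.
exists psi, u, g; split=> //; rewrite uE.
by rewrite -addrA subrK addrC subrK.
Qed.

(** * Representing classes with values in local (co)homology *)

Notation hn := (loc_hom_sheaf o n%:Z).
Notation hc := (loc_cohom_cosheaf o n%:Z).

Lemma chains_gt k c : n%:Z < k -> c \in chains k -> c = 0.
Proof.
move=> nk /chainsP[c0 _]; apply/funext => s; apply/eqP/negPn/negP => /c0.
by have := dim_le s; lia.
Qed.

Lemma chains_lt0 k c : k < 0 -> c \in chains k -> c = 0.
Proof.
move=> k0 /chainsP[c0 _]; apply/funext => s; apply/eqP/negPn/negP => /c0 sk.
by lia.
Qed.

Lemma pairs_gt p q f : n%:Z < q -> f \in pairs p q -> f = 0.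
Proof.
move=> nq /pairsP[f0 _]; apply/funext => s; apply/funext => t.
apply/eqP/negPn/negP => /f0[_ _].
by have := dim_le t; lia.
Qed.

Lemma pairs_lt0 p q f : p < 0 -> f \in pairs p q -> f = 0.
Proof.
move=> p0 /pairsP[f0 _]; apply/funext => s; apply/funext => t.
by apply/eqP/negPn/negP => /f0[_ sp _]; lia.
Qed.

Definition represents_hom f (phi : sections hn) :=
  forall sigma, represents (f sigma : sections ZC) (phi sigma).

(** For lack of [(n+1)]-simplices the relative boundaries are the chains off the star, and such a
    chain supported on the star is 0. *)
Lemma loc_hom_top_eq0 sigma c (x : loc_hom o n%:Z sigma) :
    represents (c : sections ZC) x -> (forall tau, c tau != 0 -> is_face sigma tau) ->
  (x = 0) <-> (c = 0).
Proof.
move=> cx cs; split=> [x0|c0]; last by apply/(represents_eq0 cx); rewrite c0 rpred0.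
have /rel_im_onP[y [a [yk /off_starP[_ a0] cyE]]] := (represents_eq0 cx).1 x0.
rewrite mem_dsum_chains in yk; rewrite (chains_gt _ yk) in cyE; last by lia.
rewrite raddf0 add0r in cyE.
apply/funext => t; apply/eqP/negPn/negP => ct.
by case/eqP: (ct); rewrite cyE a0// cs.
Qed.

Lemma represents_hom_ex p (phi : sections hn) : phi \in dsum hn p ->
  exists2 f, f \in pairs p n%:Z & represents_hom f phi.
Proof.
move=> /dsumP[ph pf].
have repP sigma : exists c, represents (c : sections ZC) (phi sigma) /\
    forall tau, c tau != 0 -> [/\ is_face sigma tau, (dim tau)%:Z = n%:Z & phi sigma <> 0].
  have [p0|p0] := pselect (phi sigma = 0).
    by exists 0; split=> [|t /eqP[]//]; rewrite p0; exact: represents0.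
  have rx := represents_repr (phi sigma).
  have [ck _] := loc_hom_rep rx.
  exists (restrict sigma (val (repr_of (phi sigma)))); split.
    exact: loc_hom_restrict.
  by move=> t /(restrict_neq0 ck)[].
have [f fP] := choice repP; exists f; last by move=> s; exact: (fP s).1.
apply/pairsP; split.
  move=> s t /(fP s).2[st tn ps]; split=> //.
  by apply: contrapT => sp; apply: ps; exact: ph.
by apply: sub_finite_set pf => s /= [t /(fP s).2[]].
Qed.

Lemma represents_hom_dD f phi : represents_hom f phi -> star_bound f = 0.
Proof.
move=> fp; apply/funext => s; apply/funext => r; rewrite /star_bound; case: ifP => // sr.
by have [_] := loc_hom_rep (fp s); exact.
Qed.

Lemma represents_hom_lift p f : f \in pairs p n%:Z -> star_bound f = 0 ->
  exists2 phi, phi \in dsum hn p & represents_hom f phi.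
Proof.
move=> /pairsP[fs ff] df.
have repP sigma : exists x : loc_hom o n%:Z sigma, represents (f sigma : sections ZC) x.
  apply: represents_ex; apply: mem_loc_cycles.
    by apply: (star_chains (sigma := sigma)) => t /fs[].
  by move=> r sr; have := congr1 (fun f => f sigma r) df; rewrite /star_bound sr.
pose phi : sections hn := fun sigma => sval (cid (repP sigma)).
have phiP : represents_hom f phi by move=> s; exact: svalP (cid (repP s)).
have phi0 s : phi s <> 0 -> exists t, f s t != 0.
  move=> ps; apply: contrapT => nex; apply: ps.
  apply/(represents_eq0 (phiP s)).
  suff -> : f s = 0 by exact: rpred0.
  by apply/funext => t; apply/eqP/negPn/negP => fst0; apply: nex; exists t.
exists phi => //; apply/dsumP; split.
  by move=> s sp; apply: contrapT => /phi0[t /fs[]].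
by apply: sub_finite_set ff => s /= /phi0.
Qed.

Lemma represents_hom_cobound p f phi : f \in pairs p n%:Z -> represents_hom f phi ->
  represents_hom (star_cobound f) (cobound o phi).
Proof.
move=> fP fphi s.
(* The sheaf maps keep representatives, but their alternating sum may leave the star of [s];
   restricting it preserves the class. *)
pose g : sections ZC := \sum_(i < (dim s).+1 | (0 < dim s)%N)
  (f (drop_face o s i) : sections ZC) *~ (-1) ^+ i.
have -> : (star_cobound f s : sections ZC) = restrict s g.
  apply/funext => t; rewrite /star_cobound /restrict; case: ifP => // st.
  rewrite /g sections_sumE; apply: eq_bigr => i _.
  by rewrite sections_mulzE /= -mulrzr intz mulrC.
apply: loc_hom_restrict; apply: represents_sum => i _; apply: representsMz.
exact: subquot_mapE.
Qed.

Lemma represents_hom_eq0 p f phi : f \in pairs p n%:Z -> represents_hom f phi ->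
  (phi = 0) <-> (f = 0).
Proof.
move=> /pairsP[fs _] fphi; split=> [p0|f0].
  apply/funext => s; apply/(loc_hom_top_eq0 (fphi s)); last by rewrite p0.
  by move=> t /fs[].
apply: functional_extensionality_dep => s; apply/(represents_eq0 (fphi s)).
by rewrite f0 rpred0.
Qed.

Definition represents_coh f (eta : sections hc) :=
  forall sigma, represents (f sigma : sections ZS) (eta sigma).

Notation loc_cocycles sigma := (ker_on (@cobound V X o ZS) (rel_cochain sigma n%:Z)).

Notation loc_coboundaries sigma := (im_on (@cobound V X o ZS) (rel_cochain sigma (n%:Z - 1))).

Lemma represents_cosingle sigma tau (c : sections ZS) (x : hc sigma) :
  represents c x -> represents (c *+ (sigma == tau)) (single x tau).
Proof.
exact: (@represents_single _ _ (fun s => loc_cocycles s) (fun s => loc_coboundaries s)).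
Qed.

Lemma mem_loc_cocycles sigma c :
    (forall tau, c tau != 0 -> is_face sigma tau /\ dim tau = n) ->
  (c : sections ZS) \in loc_cocycles sigma.
Proof.
move=> c0; rewrite ker_onE; apply/andP; split.
  apply/rel_cochainP; split.
    by apply/dprodP => t tn; apply/eqP/negPn/negP => /c0[_ e]; rewrite e in tn.
  by move=> t st; apply/eqP/negPn/negP => /c0[e]; rewrite e in st.
rewrite /= cobound_const; apply/eqP/funext => t; apply/eqP/negPn/negP.
move=> /zcobound_neq0[r [rt dt /c0[_ rn]]].
by have := dim_le t; lia.
Qed.

Lemma loc_cohom_supp sigma c (x : loc_cohom o n%:Z sigma) :
    represents (c : sections ZS) x ->
  forall tau, c tau != 0 -> is_face sigma tau /\ (dim tau)%:Z = n%:Z.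
Proof.
move=> /represents_cycle; rewrite ker_onE => /andP[/rel_cochainP[/dprodP cn c0] _] t ct.
split; first by apply: contraNT ct => /c0 /eqP.
by apply: contrapT => /cn ct0; rewrite ct0 in ct.
Qed.

Lemma represents_coh_ex p (eta : sections hc) : eta \in dsum hc p ->
  exists2 f, f \in pairs p n%:Z & represents_coh f eta.
Proof.
move=> /dsumP[ph pf].
have repP sigma : exists c, represents (c : sections ZS) (eta sigma) /\
    forall tau, c tau != 0 -> [/\ is_face sigma tau, (dim tau)%:Z = n%:Z & eta sigma <> 0].
  have [p0|p0] := pselect (eta sigma = 0).
    by exists 0; split=> [|t /eqP[]//]; rewrite p0; exact: represents0.
  have rx := represents_repr (eta sigma).
  exists (val (repr_of (eta sigma))); split => //.
  by move=> t /(loc_cohom_supp rx)[].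
have [f fP] := choice repP; exists f; last by move=> s; exact: (fP s).1.
apply/pairsP; split.
  move=> s t /(fP s).2[st tn ps]; split=> //.
  by apply: contrapT => sp; apply: ps; exact: ph.
by apply: sub_finite_set pf => s /= [t /(fP s).2[]].
Qed.

Lemma represents_coh_lift p f : f \in pairs p n%:Z ->
  exists2 eta, eta \in dsum hc p & represents_coh f eta.
Proof.
move=> /pairsP[fs ff].
have repP sigma : exists x : loc_cohom o n%:Z sigma, represents (f sigma : sections ZS) x.
  by apply: represents_ex; apply: mem_loc_cocycles => t /fs[st _ tn]; split=> //; lia.
pose eta : sections hc := fun sigma => sval (cid (repP sigma)).
have etaP : represents_coh f eta by move=> s; exact: svalP (cid (repP s)).
have eta0 s : eta s <> 0 -> exists t, f s t != 0.
  move=> ps; apply: contrapT => nex; apply: ps.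
  apply/(represents_eq0 (etaP s)).
  suff -> : f s = 0 by exact: rpred0.
  by apply/funext => t; apply/eqP/negPn/negP => fst0; apply: nex; exists t.
exists eta => //; apply/dsumP; split.
  by move=> s sp; apply: contrapT => /eta0[t /fs[]].
by apply: sub_finite_set ff => s /= /eta0.
Qed.

Lemma represents_coh_bound f eta : represents_coh f eta ->
  represents_coh (bound_fst f) (bound o eta).
Proof.
move=> fe r; rewrite boundE fsbig_finite; last exact: finite_star.
pose g : sections ZS := \sum_(s <- star r) \sum_(i < (dim s).+1 | (0 < dim s)%N)
  ((f s : sections ZS) *~ (-1) ^+ i) *+ (drop_face o s i == r).
have -> : (bound_fst f r : sections ZS) = g.
  apply/funext => t; rewrite /g sections_sumE; apply: eq_bigr => s _.
  rewrite sections_sumE /incidence -zcoboundMr; apply: eq_bigr => i _.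
  case: (_ =P r) => _; last by rewrite mulr0n mul0r mulr0.
  by rewrite !mulr1n mul1r sections_mulzE -mulrzr intz mulrC.
apply: represents_sum => s _; apply: represents_sum => i _.
apply: represents_cosingle; apply: representsMz; exact: subquot_mapE.
Qed.

(** Unlike for [h_n], nonzero cochains can represent 0. The primitive is chosen 0 over each [sigma]
    with [f sigma = 0], to keep its support finite. *)
Lemma represents_coh_eq0 p f eta : f \in pairs p n%:Z -> represents_coh f eta ->
  eta = 0 -> exists2 h, h \in pairs p (n%:Z - 1) & f = cobound_snd h.
Proof.
move=> fP fe e0; have /pairsP[fs ff] := fP.
have rowP sigma : exists b, (forall tau, b tau != 0 ->
    [/\ is_face sigma tau, (dim tau)%:Z = n%:Z - 1 & exists tau', f sigma tau' != 0]) /\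
    f sigma = zcobound b.
  have [nz|z] := pselect (exists tau, f sigma tau != 0); last first.
    exists 0; split=> [t /eqP[]//|]; rewrite raddf0; apply/funext => t.
    by apply/eqP/negPn/negP => ft; apply: z; exists t.
  have fe0 := fe sigma; rewrite e0 in fe0.
  have /im_onP[b /rel_cochainP[/dprodP bn b0] fb] := (represents_eq0 fe0).1 erefl.
  exists b; split=> [t bt|]; last by rewrite fb /= cobound_const.
  split=> //; first by apply: contraNT bt => /b0 /eqP.
  by apply: contrapT => /bn bt0; rewrite bt0 in bt.
have [h hP] := choice rowP; exists h; last by apply/funext => s; exact: (hP s).2.
apply: (pairs_spread fP) => s t /(hP s).1[st tq [t' ft']].
  by have [_ sp _] := fs _ _ ft'.
by exists s, t', s; split=> //; exact: is_face_refl.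
Qed.

Lemma represents_coh_coboundary p h eta : h \in pairs p (n%:Z - 1) ->
  represents_coh (cobound_snd h) eta -> eta = 0.
Proof.
move=> /pairsP[hs _] he; apply: functional_extensionality_dep => s.
apply/(represents_eq0 (he s))/im_onP; exists (h s); last by rewrite /= cobound_const.
apply/rel_cochainP; split.
  by apply/dprodP => t tn; apply/eqP/negPn/negP => /hs[_ _].
by move=> t st; apply/eqP/negPn/negP => /hs[e]; rewrite e in st.
Qed.

(** * The fundamental class and the cap products *)

Definition fund sigma tau : int := ((dim sigma == n) && (sigma == tau))%:R.

Lemma fund_ex : exists2 xi : sections hc, xi \in dprod hc n%:Z & represents_coh fund xi.
Proof.
have repP sigma : exists x : loc_cohom o n%:Z sigma, represents (fund sigma : sections ZS) x.
  apply: represents_ex; apply: (mem_loc_cocycles) => t; rewrite /fund.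
  by case: (_ =P n) => //= sn; case: (_ =P t) => // <-; rewrite is_face_refl.
pose xi : sections hc := fun sigma => sval (cid (repP sigma)).
have xiP : represents_coh fund xi by move=> s; exact: svalP (cid (repP s)).
exists xi => //; apply/dprodP => s sn; apply/(represents_eq0 (xiP s)).
suff -> : fund s = 0 by exact: rpred0.
by apply/funext => t; rewrite /fund; case: (_ =P n) => // e; rewrite e in sn.
Qed.

Section Fundamental.
Variable xi : sections hc.
Hypothesis xiP : represents_coh fund xi.

(** At an [(n-1)]-simplex [s] the boundary is represented by the signed sum of the duals of the
    cofaces of [s]. This is the coboundary of the dual of [s], a cochain vanishing off the star of
    [s]. *)
Lemma fund_cycle : bound o xi = 0.
Proof.
apply: functional_extensionality_dep => s.
apply/(represents_eq0 (represents_coh_bound xiP s))/im_onP.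
pose g t : int := ((dim s).+1 == n)%:R * (t == s)%:R.
exists g.
  apply/rel_cochainP; split.
    apply/dprodP => t tn; rewrite /g; case: (_ =P n) => [sn|_]; last by rewrite mul0r.
    by rewrite mul1r; case: (t =P s) => // ts; case: tn; rewrite ts; lia.
  move=> t st; rewrite /g; case: (t =P s) => [ts|_]; last by rewrite mulr0.
  by rewrite ts is_face_refl in st.
rewrite /= cobound_const; apply/funext => t; rewrite /bound_fst.
transitivity (((dim s).+1 == n)%:R * incidence t s); last first.
  by rewrite /incidence mulrC -zcoboundMr; apply: eq_zcobound => r _ _; rewrite /g mulrC.
rewrite (@zbound_seq _ _ [:: t])// ?big_seq1; last first.
  by move=> u _; rewrite /fund inE; case: (u =P t); rewrite ?andbF.
rewrite /fund eqxx andbT mulrC.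
case: (eqVneq (incidence t s) 0) => [->|/incidence_neq0[_ ->//]]; by rewrite !mulr0.
Qed.

Lemma cap_hom_fund p m f phi : n%:Z - p = m%:Z -> f \in pairs p n%:Z ->
  represents_hom f phi -> cap_hom n%:Z p xi phi = cap_pairs m f.
Proof.
move=> pm /pairsP[fs _] fphi; apply/funext => t; rewrite /cap_hom pm /=.
pose F s : int := (front_face o s m == t)%:R * f (back_face o s m) s.
transitivity (\sum_(s \in [set s : simplex X | (dim s)%:Z = n%:Z]%classic) F s).
  apply: eq_fsbigr => s; rewrite inE /= => sn.
  rewrite (single_const (M := int)) -mulr_natl /F; congr (_ * _).
  (* By independence of representatives, the dual cochain of [s] may be evaluated on the chosen
     chain at the back face. *)
  rewrite (pairingE (subquot_mapE _ _ (xiP s)) (fphi _)).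
  rewrite (@evaluate_supp _ _ _ _ [set s]%classic) ?fsbig_set1/=; last first.
    by move=> r /= rs; rewrite /fund; case: (s =P r) => [e|_]; [case: rs|rewrite andbF mul0r].
  have -> : fund s s = 1 by rewrite /fund eqxx andbT; case: eqP => // ne; case: ne; lia.
  by rewrite mul1r.
rewrite (@fsbig_widen _ _ _ _ _ [set: simplex X]%classic)//; last first.
  move=> s [_ /= sn]; rewrite /F; case: (eqVneq (f (back_face o s m) s) 0) => [->|].
    by rewrite mulr0.
  by move=> /fs[].
rewrite -(@fsbig_widen _ _ _ _ [set s | is_face t s]%classic)//; last first.
  move=> s [_ /= sn]; rewrite /F; case: (_ =P t) => [e|]; last by rewrite mul0r.
  by case: sn; rewrite -e front_faceP.
by rewrite fsbig_finite//; exact: finite_star.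
Qed.

Lemma cap_const_fund p m psi : 0 <= p -> n%:Z - p = m%:Z -> psi \in chains p ->
  represents_coh (cap_section m psi) (cap_const n%:Z p xi (psi : sections ZS)).
Proof.
move=> p_ge0 pm pP t; have /chainsP[p0 _] := pP; rewrite /cap_const pm /=.
pose P s := `[< is_face t s /\ dim s = n >].
pose G s : hc t := single
      (cosheaf_map hc (front_faceP o s m) (xi s)
        *~ (psi (back_face o s m) : int)) t.
have -> : (\sum_(s \in [set s : simplex X | (dim s)%:Z = n%:Z]%classic) G s) =
    \sum_(s \in [set s | P s]%classic) G s.
  apply/esym/fsbig_widen => [s /asboolP[_ /= ->]//|s [/= sn ns]].
  rewrite /G single_out//; apply: contra_notN ns => /eqP ft.
  by apply/asboolP; split; [rewrite -ft; exact: front_faceP | lia].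
rewrite fsbig_finite; last first.
  by apply: sub_finite_set (finite_star t) => s /asboolP[].
pose g : sections ZS := \sum_(s <- fset_set [set s | P s]%classic)
  ((fund s : sections ZS) *~ psi (back_face o s m)) *+ (front_face o s m == t).
have -> : (cap_section m psi t : sections ZS) = g.
  apply/funext => r; rewrite /g sections_sumE.
  set S := fset_set _.
  have memS s : (s \in S) = P s.
    rewrite in_fset_set; first by apply/idP/idP; rewrite inE.
    by apply: sub_finite_set (finite_star t) => u /asboolP[].
  transitivity (\sum_(s <- S) (r == s)%:R * cap_section m psi t s); last first.
    apply: eq_big_seq => s; rewrite memS => /asboolP[ts sn].
    rewrite sections_mulnE sections_mulzE /cap_section ifT; last by lia.
    rewrite -mulrzr intz -mulr_natl /fund sn eqxx/= [s == r]eq_sym; ring.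
  case: (boolP (r \in S)) => rS; first by rewrite big_seq_delta ?fset_uniq.
  rewrite big1_seq => [|s /andP[_ sS]]; last first.
    by case: (r =P s) => [e|_]; [rewrite e sS in rS | rewrite mul0r].
  rewrite /cap_section; case: ifP => // mr; case: (_ =P t) => [ft|_]; last by rewrite mul0r.
  rewrite mul1r; apply/eqP/negPn/negP => /p0; rewrite dim_back// => rp.
  by case/negP: rS; rewrite memS; apply/asboolP; split; [rewrite -ft front_faceP | lia].
apply: represents_sum => s _; apply: represents_cosingle.
apply: representsMz; exact: subquot_mapE.
Qed.

Lemma cap_hom0 p : cap_hom n%:Z p xi (0 : sections hn) = 0.
Proof.
apply: functional_extensionality_dep => t; apply: fsbig1 => s _.
rewrite (single_const (M := int)) [X in X *+ _](_ : _ = 0) ?mul0rn//.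
rewrite (pairingE (represents_repr _) (represents0 _ _)).
by apply: evaluate0 => r; rewrite mulr0.
Qed.

Lemma cap_const0 p : cap_const n%:Z p xi (0 : sections ZS) = 0.
Proof.
apply: functional_extensionality_dep => t; apply: fsbig1 => s _.
by rewrite mulr0z /single /eqtype.dfwith; case: eqP => // e; case: _ / e.
Qed.

Lemma dsum_eq0 (S : simplex X -> zmodType) k (x : sections S) :
  (k < 0) || (n%:Z < k) -> x \in dsum S k -> x = 0.
Proof.
move=> k0 /dsumP[xk _]; apply: functional_extensionality_dep => s; apply: xk.
by have := dim_le s; lia.
Qed.

Lemma represents_homB f f' phi phi' : represents_hom f phi -> represents_hom f' phi' ->
  represents_hom (f - f') (phi - phi').
Proof. by move=> fp fp' s; exact: representsB (fp s) (fp' s). Qed.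

Lemma represents_cohB f f' eta eta' : represents_coh f eta -> represents_coh f' eta' ->
  represents_coh (f - f') (eta - eta').
Proof. by move=> fp fp' s; exact: representsB (fp s) (fp' s). Qed.

Lemma represents_hom_fun f phi phi' : represents_hom f phi -> represents_hom f phi' ->
  phi = phi'.
Proof.
move=> fp fp'; apply: functional_extensionality_dep => s.
exact: represents_fun (fp s) (fp' s).
Qed.

Lemma represents_coh_fun f eta eta' : represents_coh f eta -> represents_coh f eta' ->
  eta = eta'.
Proof.
move=> fp fp'; apply: functional_extensionality_dep => s.
exact: represents_fun (fp s) (fp' s).
Qed.

(** * The isomorphisms in degrees from 0 to [n] *)

Section MiddleDegree.
Variables (p m : nat).
Hypothesis npm : n%:Z - p%:Z = m%:Z.

Lemma cap_hom_iso :
  exists2 Phi : {additive cohomology_c o p%:Z hn -> homology o m%:Z ZC},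
    bijective Phi & forall phi a, represents phi a ->
      represents (cap_hom n%:Z p%:Z xi phi) (Phi a).
Proof.
have cocycle phi : phi \in ker_on (@cobound V X o hn) (dsum hn p%:Z) ->
    exists f, [/\ f \in pairs p%:Z n%:Z, represents_hom f phi, star_bound f = 0, star_cobound f = 0 &
      cap_hom n%:Z p%:Z xi phi = cap_pairs m f].
  rewrite ker_onE => /andP[phiP /eqP dphi].
  have [f fP fphi] := represents_hom_ex phiP.
  exists f; split=> //; first exact: represents_hom_dD fphi.
    apply/(represents_hom_eq0 (star_cobound_pairs fP) (represents_hom_cobound fP fphi)).
    exact: dphi.
  exact: (cap_hom_fund npm fP fphi).
apply: induced_iso.
- move=> phi phi' /cocycle[f [fP fphi _ _ ->]] /cocycle[f' [fP' fphi' _ _ ->]].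
  rewrite (cap_hom_fund npm (rpredB fP fP') (represents_homB fphi fphi')).
  by rewrite raddfB.
- move=> phi /cocycle[f [fP _ df cf]]; rewrite inE => ->.
  rewrite ker_onE mem_dsum_chains (cap_pairs_chains fP)//=; last by lia.
  (* For [m = 0] the boundary lies in degree -1; the Leibniz rule covers positive [m]. *)
  rewrite bound_const; apply/eqP; case: m npm => [|m'] npm'.
    apply: (chains_lt0 (k := 0 - 1)) => //; apply: zbound_chains.
    by apply: (cap_pairs_chains fP) => //; lia.
  rewrite (cap_pairs_boundary fP) ?df ?cf ?raddf0 ?mul0rz ?subrr//; lia.
- move=> phi phiZ; have [f [fP fphi df cf ->]] := cocycle _ phiZ.
  apply/im_onP/im_onP => [[c]|[chi /represents_hom_ex[h hP hchi] phiE]].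
    rewrite mem_dsum_chains => cP; rewrite /= bound_const => fc.
    case: p npm fP phiZ => [|p'] npm' fP phiZ.
      have nm : n%:Z = m%:Z by lia.
      rewrite nm in fP.
      (* For [p = 0] the preimage [h] would live on [(n+1)]-simplices, so [f] is 0. *)
      have [h [hP _ hf]] := descend_boundary0 fP cf cP fc.
      have f0 : f = 0 by rewrite -hf (pairs_gt _ hP) ?raddf0//; lia.
      exists 0; rewrite ?rpred0// raddf0.
      by rewrite -nm in fP; apply/(represents_hom_eq0 fP fphi).
    have [| |h [hP hf dh]] := descend_boundary (m := m) fP _ _ df cf cP fc.
    - by lia.
    - by [].
    have [chi chiP hchi] := represents_hom_lift hP dh.
    exists chi; first by have -> : p'.+1%:Z - 1 = p'%:Z by lia.
    apply: (represents_hom_fun fphi); rewrite -hf.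
    exact: (represents_hom_cobound hP hchi).
  have fE : f = star_cobound h.
    apply: subr0_eq; have cP := star_cobound_pairs hP; rewrite subrK in cP.
    apply/(represents_hom_eq0 (rpredB fP cP)
      (represents_homB fphi (represents_hom_cobound hP hchi))).
    by rewrite phiE subrr.
  case: p npm hP => [|p'] npm' hP.
    by exists 0; rewrite ?rpred0// fE (pairs_lt0 _ hP)// !raddf0.
  (* As [star_bound h = 0], the Leibniz rule gives this chain the boundary [cap_pairs m f]; the
     factor undoes the sign. *)
  exists (cap_pairs m.+1 h *~ (- (-1) ^+ m)).
    rewrite mem_dsum_chains rpredMz//; have -> : m%:Z + 1 = m.+1%:Z by lia.
    by apply: (cap_pairs_chains hP); lia.
  rewrite /= bound_const (raddfMz zbound)/= (cap_pairs_boundary hP); try lia.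
  rewrite (represents_hom_dD hchi) raddf0 sub0r -fE mulrNz mulNrz opprK.
  by rewrite -mulrzA -exprD addnn -mul2n exprM sqrrN !expr1n.
- move=> c; rewrite ker_onE mem_dsum_chains => /andP[cP /=].
  rewrite bound_const => /eqP dc.
  have [| | | | |f [fP df cf [b bP bE]]] :=
    lift_cycle (j := p) (m := m) (vertex_sum_pairs cP).
  - by [].
  - by rewrite addr0.
  - by lia.
  - by rewrite star_bound_vertex_sum dc; apply/funext => s; apply/funext => t; rewrite /vertex_sum if_same.
  - exact: star_cobound_vertex_sum.
  rewrite add0r in fP.
  have [phi phiP fphi] := represents_hom_lift fP df.
  exists phi.
    rewrite ker_onE phiP; apply/eqP.
    by apply/(represents_hom_eq0 (star_cobound_pairs fP) (represents_hom_cobound fP fphi)).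
  apply/im_onP; exists b; first by rewrite mem_dsum_chains.
  by rewrite /= bound_const -bE cap_pairs_vertex_sum// (cap_hom_fund npm fP fphi).
Qed.

Lemma cap_const_iso :
  exists2 Psi : {additive cohomology_c o p%:Z ZS -> homology o m%:Z hc},
    bijective Psi & forall (psi : sections ZS) a, represents psi a ->
      represents (cap_const n%:Z p%:Z xi psi) (Psi a).
Proof.
have capE psi : psi \in chains p%:Z ->
    represents_coh (cap_section m psi) (cap_const n%:Z p%:Z xi (psi : sections ZS)).
  exact: cap_const_fund.
have sP psi : psi \in chains p%:Z -> cap_section m psi \in pairs m%:Z n%:Z.
  by move=> pP; rewrite (_ : n%:Z = m%:Z + p%:Z); [exact: cap_section_pairs | lia].
have cocycle (psi : sections ZS) : psi \in ker_on (@cobound V X o ZS) (dsum ZS p%:Z) ->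
    psi \in chains p%:Z /\ zcobound psi = 0.
  by rewrite ker_onE mem_dsum_cochains => /andP[-> /eqP]; rewrite /= cobound_const.
apply: induced_iso.
- move=> psi psi' /cocycle[pP _] /cocycle[pP' _].
  apply: (represents_coh_fun (capE _ (rpredB pP pP'))).
  by rewrite raddfB; apply: represents_cohB; exact: capE.
- move=> psi /cocycle[pP cp]; rewrite inE ker_onE; apply/andP; split.
    have /pairsP[s0 sf] := sP _ pP.
    have cap0 t : cap_const n%:Z p%:Z xi psi t <> 0 -> exists r, cap_section m psi t r != 0.
      move=> ct; apply: contrapT => nex; apply: ct.
      apply/(represents_eq0 (capE _ pP t)).
      suff -> : cap_section m psi t = 0 by exact: rpred0.
      by apply/funext => r; apply/eqP/negPn/negP => sr; apply: nex; exists r.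
    apply/dsumP; split.
      by move=> t tm; apply: contrapT => /cap0[r /s0[]].
    by apply: sub_finite_set sf => t /= /cap0.
  apply/eqP; have dcap := represents_coh_bound (capE _ pP).
  case: m npm sP dcap => [|m'] npm' sP dcap.
    rewrite (pairs_lt0 _ (bound_fst_pairs (sP _ pP))) in dcap => //.
    apply: (represents_coh_coboundary (p := 0) (h := 0)) => //; first exact: rpred0.
    by rewrite raddf0.
  rewrite -cap_section_cocycle// in dcap.
  apply: (represents_coh_coboundary _ dcap).
  have -> : n%:Z - 1 = m'%:Z + p%:Z by lia.
  exact: cap_section_pairs.
- move=> psi /cocycle[pP cp].
  apply/im_onP/im_onP => [[eta etaP capB]|[chi]].
    have [g gP geta] := represents_coh_ex etaP.
    have cap0 : represents_coh (cap_section m psi - bound_fst g) (cap_const n%:Z p%:Z xi psi - bound o eta).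
      exact: represents_cohB (capE _ pP) (represents_coh_bound geta).
    have dgP := bound_fst_pairs gP; rewrite addrK in dgP.
    (* The equation holds between classes; between representatives it leaves the error
       [cobound_snd h]. *)
    have [|h hP hE] := represents_coh_eq0 (rpredB (sP _ pP) dgP) cap0.
      by rewrite capB subrr.
    have [| | | |chi chiP chiE] := descend_coboundary (m := m) pP _ cp _ _ gP hP.
    - by [].
    - by lia.
    - by [].
    - by rewrite -hE addrC subrK.
    exists (chi : sections ZS); first by rewrite mem_dsum_cochains.
    by rewrite /= cobound_const.
  rewrite mem_dsum_cochains /= cobound_const => chiP psiE.
  case: p npm pP chiP sP capE => [|p'] npm' pP chiP sP capE.
    exists 0; first exact: rpred0.
    have -> : psi = 0 by rewrite psiE (chains_lt0 _ chiP) ?raddf0.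
    by rewrite cap_const0 raddf0.
  have sm : cap_section m.+1 chi \in pairs (m%:Z + 1) n%:Z.
    have nE : n%:Z = m.+1%:Z + (p'.+1%:Z - 1) by lia.
    have mE : m%:Z + 1 = m.+1%:Z by lia.
    by rewrite nE mE; apply: cap_section_pairs => //; lia.
  have [eta etaP seta] := represents_coh_lift sm.
  (* The Leibniz rule for [chi], multiplied by [(-1) ^+ m], writes the cap of [psi] as the boundary
     of this chain plus a coboundary. *)
  exists (eta *~ - (-1) ^+ m); first by rewrite rpredMz.
  apply: subr0_eq; apply: (represents_coh_coboundary (p := m%:Z) (h := cap_section m chi *~ (-1) ^+ m)).
    rewrite rpredMz//; have -> : n%:Z - 1 = m%:Z + (p'.+1%:Z - 1) by lia.
    exact: cap_section_pairs.
  have -> : cobound_snd (cap_section m chi *~ (-1) ^+ m) = cap_section m psi - bound_fst (cap_section m.+1 chi *~ - (-1) ^+ m).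
    rewrite (raddfMz cobound_snd) (raddfMz bound_fst)/= cobound_snd_cap_section -psiE mulrNz opprK mulrzDl -mulrzA.
    rewrite -exprD addnn -mul2n exprM sqrrN !expr1n mulr1z. exact: addrC.
  apply: represents_cohB; first exact: capE.
  apply: represents_coh_bound => t.
  have -> : ((cap_section m.+1 chi *~ - (-1) ^+ m) t : sections ZS) =
      (cap_section m.+1 chi t : sections ZS) *~ - (-1) ^+ m.
    by apply/funext => r; rewrite !fun_mulz sections_mulzE.
  by rewrite sections_mulzE; exact: representsMz.
- move=> eta; rewrite ker_onE => /andP[etaP /eqP deta].
  have [z zP zeta] := represents_coh_ex etaP.
  have [|y yP yE] := represents_coh_eq0 (bound_fst_pairs zP) (represents_coh_bound zeta).
    exact: deta.
  have [| | | |psi [g [h [pP cp gP hP zE]]]] := lift_cocycle (m := m) (q := n%:Z)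
    (w := 0) _ _ zP yP _ yE.
  - by lia.
  - by [].
  - exact: rpred0.
  - by rewrite raddf0; apply: (pairs_gt _ (cobound_snd_pairs zP)); lia.
  have pE : n%:Z - m%:Z = p%:Z by lia.
  rewrite pE in pP.
  exists (psi : sections ZS).
    by rewrite ker_onE mem_dsum_cochains pP /= cobound_const cp.
  have [eta' eta'P geta'] := represents_coh_lift gP.
  apply/im_onP; exists eta' => //.
  apply: subr0_eq; apply: (represents_coh_coboundary hP).
  have -> : cobound_snd h = z - cap_section m psi - bound_fst g by rewrite zE; ring.
  apply: represents_cohB; last exact: represents_coh_bound geta'.
  by apply: represents_cohB => //; exact: capE.
Qed.

End MiddleDegree.
End Fundamental.

End Duality.

End LocalDuality.

Theorem theorem1 (V : choiceType) (X : lf_complex V) (o : orientation X)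
    (n : nat) (hCM : locally_CM o n) :
  exists2 x : homology_lf o n%:Z (loc_cohom_cosheaf o n%:Z),
    fundamental_class x &
    forall p : int,
      (exists2 Phi : {additive cohomology_c o p (loc_hom_sheaf o n%:Z)
                        -> homology o (n%:Z - p) (const_cosheaf X)},
         bijective Phi &
         forall xi phi a, represents xi x -> represents phi a ->
           represents (cap_hom n%:Z p xi phi) (Phi a)) /\
      (exists2 Psi : {additive cohomology_c o p (const_sheaf X)
                        -> homology o (n%:Z - p) (loc_cohom_cosheaf o n%:Z)},
         bijective Psi &
         forall xi psi a, represents xi x -> represents psi a ->
           represents (cap_const n%:Z p xi psi) (Psi a)).
Proof.
have exactX := star_exact_CM hCM.
have [xi xiD xiP] := fund_ex exactX.
have [|x xix] := @represents_ex _ (ker_on (@bound V X o (loc_cohom_cosheaf o n%:Z))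
    (dprod (loc_cohom_cosheaf o n%:Z) n%:Z))
  (im_on (@bound V X o (loc_cohom_cosheaf o n%:Z))
    (dprod (loc_cohom_cosheaf o n%:Z) (n%:Z + 1))) xi.
  by rewrite ker_onE xiD /= (fund_cycle xiP).
exists x.
  exists xi => // s sn; suff -> : single (1 : const_sheaf X s) = fund n s by exact: xiP.
  apply/funext => t; rewrite (single_const (M := int)) /fund sn eqxx.
  by case: (s == t).
(* Locally finite boundaries in degree [n] come from [(n+1)]-simplices, of which there are none, so
   the class has a single representing cycle. *)
have xi_unique xi' : represents xi' x -> xi' = xi.
  move=> xi'x; have /im_onP[y /dprodP yn /= yE] := (represents_eq xi'x xix).1 erefl.
  apply: subr0_eq; rewrite yE; suff -> : y = 0 by rewrite raddf0.
  apply: functional_extensionality_dep => s; apply: yn.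
  by have := dim_le exactX s; lia.
move=> p; split.
  suff [Phi bPhi PhiE] : exists2 Phi : {additive cohomology_c o p (loc_hom_sheaf o n%:Z)
      -> homology o (n%:Z - p) (const_cosheaf X)}, bijective Phi &
      forall phi a, represents phi a -> represents (cap_hom n%:Z p xi phi) (Phi a).
    by exists Phi => // xi' phi a /xi_unique ->; exact: PhiE.
  case: (boolP ((p < 0) || (n%:Z < p))) => [pn|]; last first.
    move=> pn; have {pn} [p0 pn] : 0 <= p /\ p <= n%:Z by split; lia.
  case: p p0 pn => // p _ pn.
    have npm : n%:Z - p%:Z = (n - p)%N%:Z by lia.
    by rewrite npm; exact: cap_hom_iso.
  apply: trivial_iso; first exact: cap_hom0.
    by move=> z; rewrite ker_onE => /andP[/(dsum_eq0 exactX) + _]; apply.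
  move=> z; rewrite ker_onE => /andP[/(dsum_eq0 exactX) + _]; apply; lia.
suff [Psi bPsi PsiE] : exists2 Psi : {additive cohomology_c o p (const_sheaf X)
    -> homology o (n%:Z - p) (loc_cohom_cosheaf o n%:Z)}, bijective Psi &
    forall psi a, represents psi a -> represents (cap_const n%:Z p xi psi) (Psi a).
  by exists Psi => // xi' phi a /xi_unique ->; exact: PsiE.
case: (boolP ((p < 0) || (n%:Z < p))) => [pn|]; last first.
  move=> pn; have {pn} [p0 pn] : 0 <= p /\ p <= n%:Z by split; lia.
  case: p p0 pn => // p _ pn.
  have npm : n%:Z - p%:Z = (n - p)%N%:Z by lia.
  by rewrite npm; exact: cap_const_iso.
apply: trivial_iso; first exact: cap_const0.
  by move=> z; rewrite ker_onE => /andP[/(dsum_eq0 exactX) + _]; apply.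
move=> z; rewrite ker_onE => /andP[/(dsum_eq0 exactX) + _]; apply; lia.
Qed.
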